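(* The process $(X,\mathbb{P}_x^\updownarrow)_{x\in\mathcal{H}_0}$ is transient.
   Context: $\mathcal{D}[0,\infty)$ is the space of càdlàg paths $\omega:[0,\infty)\to\mathbb{R}\cup\{\Delta\}$ ($\Delta$ a cemetery point) with lifetime $\zeta(\omega)=\inf\{s:\omega_s=\Delta\}$. $X=(X_t)_{t\ge0}$ is the coordinate process, with completed right-continuous filtration $(\mathcal{F}_t)_{t\ge0}$; under $\mathbb{P}=\mathbb{P}_0$ it is a real-valued Lévy process started at $0$, and $\mathbb{P}_x$ is the law of $X+x$ under $\mathbb{P}$. The characteristic exponent $\psi$ is defined by $\mathbb{E}[e^{i\lambda X_t}]=e^{-t\psi(\lambda)}$. Standing assumptions: (1) $0$ is regular for itself under $\mathbb{P}$; (2) $(X,\mathbb{P})$ is not a compound Poisson process; (3) $\int_{\mathbb{R}}\frac{d\lambda}{q+\mathrm{Re}(\psi(\lambda))}<\infty$ for all $q>0$; (4) $\int_{\mathbb{R}}\left|\mathrm{Re}\left(\frac{1-e^{i\lambda}}{\psi(\lambda)}\right)\right|d\lambda<\infty$. For $q>0$, $u_q$ is the continuous function such that $\mathbb{E}_x\left[\int_0^\infty e^{-qt}f(X_t)dt\right]=\int_{\mathbb{R}}u_q(y-x)f(y)dy$ for bounded Borel $f$. $T_0=\inf\{t>0:X_t=0\}$. $L$ is the continuous local time at $0$ of $(X,\mathbb{P})$, normalized so that $\mathbb{E}\left(\int_0^\infty e^{-qt}dL_t\right)=u_q(0)$ for all $q>0$, and $n$ is the associated Itô excursion measure away from $0$;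 $n(F)=\int F\,dn$. $h(x)=\lim_{q\to0}[u_q(0)-u_q(-x)]$, $x\in\mathbb{R}$; this limit exists and is finite and nonnegative, $h$ is continuous, $\mathbb{E}_x[h(X_t),t<T_0]=h(x)$ and $n(h(X_t)\mathbf{1}_{\{t<\zeta\}})=1$ for all $t>0$, $x\in\mathbb{R}$. Put $\mathcal{H}=\{x:h(x)>0\}$, $\mathcal{H}_0=\mathcal{H}\cup\{0\}$. $(\mathbb{P}_x^\updownarrow)_{x\in\mathcal{H}_0}$ is the (Markovian) family of probability measures such that for all $t>0$ and $\Lambda\in\mathcal{F}_t$, $$\mathbb{P}_x^\updownarrow(\Lambda)=\frac{1}{h(x)}\mathbb{E}_x\left(\mathbf{1}_\Lambda h(X_t)\mathbf{1}_{\{t<T_0\}}\right)\ (x\in\mathcal{H}),\qquad \mathbb{P}_0^\updownarrow(\Lambda)=n\left(\mathbf{1}_\Lambda h(X_t)\mathbf{1}_{\{t<\zeta\}}\right).$$ Transience means: for every compact set $K\subset\mathcal{H}_0$ and every $x\in\mathcal{H}_0$, the last exit time $\sup\{t>0:X_t\in K\}$ (with $\sup\emptyset=0$) is finite $\mathbb{P}_x^\updownarrow$-almost surely. *)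

(* Defs.v *)
From HB Require Import structures.
From mathcomp Require Import all_boot all_order all_algebra.
From mathcomp Require Import complex.
From mathcomp Require Import all_classical all_reals all_analysis measurable_realfun.
From mathcomp Require Import lebesgue_stieltjes_measure.

Set Implicit Arguments.
Unset Strict Implicit.
Unset Printing Implicit Defensive.

Import Order.TTheory GRing.Theory Num.Theory.
Import numFieldNormedType.Exports.

Local Open Scope classical_set_scope.
Local Open Scope ring_scope.

Section cadlag_paths.
Variable R : realType.
Implicit Types (w : R -> option R) (s t x : R).

(* R u {Delta} is [option R], with Delta = None an isolated point: it carries
   the topology induced by this injection into bool * R. *)
Definition state_embed (o : option R) : bool * R := (isSome o, odflt 0 o).

(* Paths are indexed by [0, +oo[; they are encoded as functions on R that are
   constant on ]-oo, 0], so that equality of paths is equality on [0, +oo[. *)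
Definition cadlag w : Prop :=
  [/\ forall t, t < 0 -> w t = w 0,
      forall s t, 0 <= s -> s <= t -> w s = None -> w t = None,
      forall t, 0 <= t -> state_embed (w s) @[s --> t^'+] --> state_embed (w t)
    & forall t, 0 < t -> exists l : bool * R, state_embed (w s) @[s --> t^'-] --> l].

Record cadlag_path := CadlagPath {
  path_fun :> R -> option R ;
  path_cadlag : cadlag path_fun }.

Lemma cadlag_path_eq (v w : cadlag_path) : (forall t, v t = w t) -> v = w.
Proof.
case: v w => [v vc] [w wc] /= vw.
have E : v = w by apply/funext.
by rewrite E in vc *; congr CadlagPath; exact: Prop_irrelevance.
Qed.

Lemma cadlag_cst (o : option R) : cadlag (fun=> o).
Proof.
by split => // t _; [exact: cvg_cst | exists (state_embed o); exact: cvg_cst].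
Qed.

HB.instance Definition _ := gen_eqMixin cadlag_path.
HB.instance Definition _ := gen_choiceMixin cadlag_path.
HB.instance Definition _ :=
  isPointed.Build cadlag_path (CadlagPath (cadlag_cst None)).

(* The event {X_t \in A}, for A a set of real numbers. *)
Definition coord_event t (A : set R) : set cadlag_path :=
  [set w | exists2 x, w t = Some x & A x].

(* The natural filtration sigma(X_s, s <= t), its right-continuous version, and
   sigma(X_s, s >= 0); {X_s = Delta} is the complement of {X_s \in R}. *)
Definition natural_filtration t : set (set cadlag_path) :=
  <<s [set B | exists s A, [/\ 0 <= s <= t, measurable A & B = coord_event s A]] >>.

Definition right_filtration t : set (set cadlag_path) :=
  [set B | forall s, t < s -> natural_filtration s B].

Definition cylinders : set (set cadlag_path) :=
  [set B | exists s A, [/\ 0 <= s, measurable A & B = coord_event s A]].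

Let cylinders0 : <<s cylinders >> set0. Proof. exact: sigma_algebra0. Qed.

Let cylindersC A : <<s cylinders >> A -> <<s cylinders >> (~` A).
Proof. by move=> cA; rewrite -setTD; exact: sigma_algebraCD. Qed.

Let cylindersU (F : (set cadlag_path)^nat) :
  (forall i, <<s cylinders >> (F i)) -> <<s cylinders >> (\bigcup_i F i).
Proof. exact: sigma_algebra_bigcup. Qed.

HB.instance Definition _ := @isMeasurable.Build default_measure_display
  cadlag_path <<s cylinders >> cylinders0 cylindersC cylindersU.

(* X_t as a real number; 0 is a dummy value on {X_t = Delta}. *)
Definition state (w : cadlag_path) t : R := odflt 0 (w t).

Definition lifetime (w : cadlag_path) : \bar R :=
  ereal_inf [set s%:E | s in [set s | 0 <= s /\ w s = None]].

Definition hitting_time0 (w : cadlag_path) : \bar R :=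
  ereal_inf [set t%:E | t in [set t | 0 < t /\ w t = Some 0]].

(* 0 is inserted so that the supremum is 0 when K is never visited. *)
Definition last_exit_time (K : set R) (w : cadlag_path) : \bar R :=
  ereal_sup (0%E |` [set t%:E | t in [set t | 0 < t /\ coord_event t K w]]).

Let cvg_translate (F : set_system R) {FF : Filter F} (f : R -> option R) x
    (l : bool * R) : state_embed (f s) @[s --> F] --> l ->
  state_embed (omap (+%R x) (f s)) @[s --> F]
    --> ((l.1, if l.1 then x + l.2 else 0) : bool * R).
Proof.
case: l => b r fl /=.
have fb : \forall s \near F, isSome (f s) = b.
  have : isSome (f s) @[s --> F] --> b.
    exact: cvg_comp fl (@cvg_fst _ _ (nbhs b) (nbhs r) _).
  by move=> /(_ [set b]) fb; apply: fb; exact/principal_filterP.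
have fr : odflt 0 (f s) @[s --> F] --> r.
  exact: cvg_comp fl (@cvg_snd _ _ (nbhs b) (nbhs r) _).
have f1 : isSome (omap (+%R x) (f s)) @[s --> F] --> b.
  apply: cvg_near_cst.
  by apply: filterS fb => s; case: (f s).
suff f2 : odflt 0 (omap (+%R x) (f s)) @[s --> F] --> (if b then x + r else 0).
  exact: cvg_pair f1 f2.
case: b {f1} fl fb => fl fb.
  have fr' : x + odflt 0 (f s) @[s --> F] --> x + r.
    by apply: cvgD fr; exact: cvg_cst.
  apply: cvg_trans fr'; apply: near_eq_cvg.
  by apply: filterS fb => s; rewrite /state_embed/=; case: (f s).
apply: cvg_near_cst.
by apply: filterS fb => s; case: (f s).
Qed.

Lemma cadlag_translate x (w : cadlag_path) : cadlag (fun t => omap (+%R x) (w t)).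
Proof.
case: w => w /= [w0 wD wr wl]; split.
- by move=> t /w0 ->.
- by move=> s t s0 st; case E : (w s) => // _; rewrite (wD s t).
- move=> t t0; have E : state_embed (omap (+%R x) (w t)) =
      ((state_embed (w t)).1,
       if (state_embed (w t)).1 then x + (state_embed (w t)).2 else 0).
    by case: (w t).
  by rewrite E; exact: cvg_translate (wr t t0).
- by move=> t /wl[l /(cvg_translate (x := x)) ?]; eexists; eassumption.
Qed.

Definition translate x (w : cadlag_path) := CadlagPath (cadlag_translate x w).

Let cvg_addl_right (u s : R) : u + z @[z --> s^'+] --> (u + s)^'+.
Proof.
move=> A [/= e e0 eA]; exists e => //= z /= ze sz.
by apply: eA => /=; rewrite ?ltrD2l// opprD addrACA subrr add0r.
Qed.

Let cvg_addl_left (u s : R) : u + z @[z --> s^'-] --> (u + s)^'-.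
Proof.
move=> A [/= e e0 eA]; exists e => //= z /= ze sz.
by apply: eA => /=; rewrite ?ltrD2l// opprD addrACA subrr add0r.
Qed.

Lemma cadlag_shift t (w : cadlag_path) :
  cadlag (fun s => w (Num.max 0 t + Num.max 0 s)).
Proof.
case: w => w /= [w0 wD wr wl].
have u0 : 0 <= Num.max 0 t by rewrite le_max lexx.
move: (Num.max 0 t) u0 => u u0; split.
- by move=> s s0; rewrite maxxx max_l// ltW.
- move=> s s' s0 ss'; rewrite !max_r//; last exact: le_trans ss'.
  by apply: wD; rewrite ?lerD2l ?addr_ge0.
- move=> s s0; rewrite (max_r s0).
  have := cvg_comp _ _ (cvg_addl_right (u := u) (s := s)) (wr _ (addr_ge0 u0 s0)).
  apply: cvg_trans; apply: near_eq_cvg; near=> z => /=.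
  by rewrite max_r// (le_trans s0).
- move=> s s0; have [|l wl'] := wl (u + s); first by rewrite ltr_wpDl.
  exists l; have := cvg_comp _ _ (cvg_addl_left (u := u) (s := s)) wl'.
  apply: cvg_trans; apply: near_eq_cvg; near=> z => /=.
  rewrite max_r//; near: z; exact: nbhs_left_ge.
Unshelve. all: by end_near. Qed.

(* The shift theta_t, for t >= 0 only; Num.max 0 s makes the shifted path
   constant on negative times. *)
Definition path_shift t (w : cadlag_path) := CadlagPath (cadlag_shift t w).

Lemma measurable_translate x : measurable_fun setT (translate x).
Proof.
apply: (@measurability _ _ _ _ setT _ cylinders) => //.
move=> _ [_ [s [A [s0 mA ->]]] <-]; rewrite setTI; apply: sub_sigma_algebra.
exists s, (+%R x @^-1` A); split => //.
  by rewrite -[X in measurable X]setTI; exact: measurable_funD.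
apply/seteqP; split=> w /=.
  by move=> [y]; rewrite /translate/=; case E : (w s) => [z|]//= [<-] Az; exists z.
by move=> [z /= E Az]; exists (x + z); rewrite //= E.
Qed.

HB.instance Definition _ x :=
  isMeasurableFun.Build _ _ _ _ (translate x) (measurable_translate x).

End cadlag_paths.

Section levy_processes.
Variable R : realType.
Local Notation D := (cadlag_path R).
Local Notation leb := (@lebesgue_measure R).
Implicit Types (P : probability D R) (n : {measure set D -> \bar R}).

(* The sigma-algebra of D is not completed and sets such as {t < T_0} are only
   measurable for its completions. Almost sure statements are therefore written
   with {ae _, _}, i.e., outside a subset of a measurable null set, and \int is
   the supremum over the simple measurable functions below, which for a
   nonnegative function measurable for the completion is the integral against
   the completed measure. *)

(* P_x, the law of X + x under P. *)
Definition law_from P (x : R) : probability D R := distribution P (translate x).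

Definition completed_filtration (mu : {measure set D -> \bar R}) (t : R)
    : set (set D) :=
  [set A | exists2 B, right_filtration t B &
                      mu.-negligible ((A `\` B) `|` (B `\` A))].

Definition increment_event (s t : R) (A : set R) : set D :=
  [set w | A (state w (s + t) - state w s)].

Definition levy_process P : Prop :=
  [/\ {ae P, forall w : D, w 0 = Some 0 /\ lifetime w = +oo%E},
      forall s t Lambda A, 0 <= s -> 0 <= t ->
        natural_filtration s Lambda -> measurable A ->
        P (Lambda `&` increment_event s t A) =
        (P Lambda * P (increment_event s t A))%E
    & forall s t A, 0 <= s -> 0 <= t -> measurable A ->
        P (increment_event s t A) = P (coord_event t A)].

Definition expi (x : R) : R[i] := Complex (cos x) (sin x).

Definition cexp (z : R[i]) : R[i] := real_complex R (expR (complex.Re z)) * expi (complex.Im z).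

Definition char_fun d (T : measurableType d) (mu : probability T R) (f : T -> R)
    (lambda : R) : R[i] :=
  Complex (\int[mu]_w cos (lambda * f w))%R (\int[mu]_w sin (lambda * f w))%R.

Definition char_exponent P (psi : R -> R[i]) : Prop :=
  forall t lambda, 0 <= t ->
    char_fun P (fun w => state w t) lambda =
    cexp (- (real_complex R t * psi lambda)).

(* The distribution of X_t is compound Poisson for all t, with jump rate c and
   jump law sigma. *)
Definition compound_poisson (psi : R -> R[i]) : Prop :=
  exists (c : R) (sigma : probability (measurableTypeR R) R),
    [/\ 0 < c, sigma [set 0] = 0%E &
        forall lambda, psi lambda =
          real_complex R c * (1 - char_fun sigma idfun lambda)].

Definition regular_for_itself P : Prop :=
  {ae P, forall w, hitting_time0 w = 0%E}.

Definition resolvent_density P (q : R) (uq : R -> R) : Prop :=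
  continuous uq /\
  forall (f : R -> R) (x : R), measurable_fun setT f ->
    (exists M, forall y, `|f y| <= M) ->
    (\int[law_from P x]_w \int[leb]_(t in `[0%R, +oo[)
        (expR (- (q * t)) * f (state w t))%:E =
     \int[leb]_y (uq (y - x) * f y)%:E)%E.

(* A continuous additive functional of X whose growth set is the closure of
   {t : X_t = 0}; this determines L up to a multiplicative constant. *)
Definition local_time0 P (L : D -> cumulative R R) : Prop :=
  forall x, let Px := law_from P x in
  [/\ forall t A, 0 <= t -> measurable A ->
        completed_filtration Px t [set w | A (L w t)],
      {ae Px, forall w, continuous (L w) /\ forall t, t <= 0 -> L w t = 0},
      forall s t, 0 <= s -> 0 <= t ->
        {ae Px, forall w, L w (s + t) = L w s + L (path_shift s w) t}
    & {ae Px, forall w, forall a b, 0 <= a -> a < b ->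
        (L w a < L w b <-> exists t, [/\ a < t, t < b & w t = Some 0])}].

Definition local_time0_normalized P (L : D -> cumulative R R) (u : R -> R -> R)
    : Prop :=
  forall q, 0 < q ->
    (\int[P]_w \int[lebesgue_stieltjes_measure (L w)]_(t in `[0%R, +oo[)
        (expR (- (q * t)))%:E = (u q 0)%:E)%E.

(* The right-continuous inverse of L and its left limit. *)
Definition inv_local_time (L : D -> cumulative R R) (w : D) (s : R) : \bar R :=
  ereal_inf [set t%:E | t in [set t | 0 <= t /\ s < L w t]].

Definition inv_local_time_left (L : D -> cumulative R R) (w : D) (s : R)
    : \bar R :=
  ereal_inf [set t%:E | t in [set t | 0 <= t /\ s <= L w t]].

(* The excursion process of w, as the set of pairs (s, e) where e is the
   excursion away from 0 made at local time s, sent to Delta at its end. *)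
Definition excursions (L : D -> cumulative R R) (w : D) : set (R * D) :=
  [set p : R * D | exists g : R,
    [/\ 0 < p.1,
        inv_local_time_left L w p.1 = g%:E,
        (g%:E < inv_local_time L w p.1)%E
      & forall t : R, 0 <= t ->
          p.2 t = if ((g + t)%:E < inv_local_time L w p.1)%E
                  then w (g + t) else None]].

(* N is a random set of points; #(N `&` B) is Poisson with mean mu B, and
   these counts are independent for disjoint B's. *)
Definition poisson_point_process d (T : measurableType d) (Q : probability T R)
    d' (S : measurableType d') (N : T -> set S) (mu : set S -> \bar R) : Prop :=
  (forall (B : set S) (j : nat), measurable B -> (mu B < +oo)%E ->
     measurable [set a | counting (N a `&` B) = (j%:R : R)%:E]) /\
  (forall (k : nat) (B : 'I_k -> set S) (j : 'I_k -> nat),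
     (forall i, measurable (B i)) -> (forall i, (mu (B i) < +oo)%E) ->
     trivIset setT B ->
     Q (\bigcap_i [set a | counting (N a `&` B i) = ((j i)%:R : R)%:E]) =
     (\prod_(i < k) (fine (mu (B i)) ^+ j i / (j i)`!%:R *
                     expR (- fine (mu (B i)))))%:E).

(* The points up to, and including, the first path of infinite lifetime. *)
Definition stopped (N : set (R * D)) : set (R * D) :=
  [set p : R * D | N p /\ forall p', N p' -> p'.1 < p.1 -> (lifetime p'.2 < +oo)%E].

(* On a possibly enlarged probability space (T, Q), the excursion process is a
   Poisson point process of intensity ds n(de), stopped at the first excursion of
   infinite lifetime (if any). *)
Definition ito_excursion_measure P (L : D -> cumulative R R)
    (n : {sigma_finite_measure set D -> \bar R}) : Prop :=
  exists (d : measure_display) (T : measurableType d) (Q : probability T R)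
         (X : {mfun T >-> D}) (N : T -> set (R * D)),
    [/\ forall A, measurable A -> Q (X @^-1` A) = P A,
        poisson_point_process Q N
          (fun B => (leb \x n)%E (B `&` (`]0%R, +oo[ `*` setT)))
      & {ae Q, forall a, excursions L (X a) = stopped (N a)}].

Definition posset (h : R -> R) : set R := [set x | 0 < h x].

Definition posset0 (h : R -> R) : set R := posset h `|` [set 0].

(* Pud x is the law P_x^{updown}, for x in posset0 h; its values at other x are
   irrelevant. Lambda ranges over the right-continuous filtration without null
   sets: adding them would change nothing for posset h, while at 0 the null sets
   of P cannot be added because n charges some of them, e.g. {0 < T_0}. *)
Definition avoiding_zero_laws P n (h : R -> R) (Pud : R -> probability D R)
    : Prop :=
  (forall x t Lambda, posset h x -> 0 < t -> right_filtration t Lambda ->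
     Pud x Lambda =
     ((h x)^-1%:E *
      \int[law_from P x]_(w in Lambda `&` [set w | t%:E < hitting_time0 w])
        (h (state w t))%:E)%E) /\
  (forall t Lambda, 0 < t -> right_filtration t Lambda ->
     Pud 0 Lambda =
     (\int[n]_(w in Lambda `&` [set w | t%:E < lifetime w])
        (h (state w t))%:E)%E).

Definition markov_family (H : set R) (Q : R -> probability D R) : Prop :=
  forall x t Lambda Gamma, H x -> 0 < t -> right_filtration t Lambda ->
    measurable Gamma ->
    Q x (Lambda `&` path_shift t @^-1` Gamma) =
    (\int[Q x]_(w in Lambda `&` coord_event t H) Q (state w t) Gamma)%E.

Definition transient (H : set R) (Q : R -> probability D R) : Prop :=
  forall (K : set R) x, compact K -> K `<=` H -> H x ->
    {ae Q x, forall w, (last_exit_time K w < +oo)%E}.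

End levy_processes.

(* Main.v *)
Require Import Defs.
From HB Require Import structures.
From mathcomp Require Import all_boot all_order all_algebra.
From mathcomp Require Import complex.
From mathcomp Require Import all_classical all_reals all_analysis measurable_realfun.
From mathcomp Require Import lebesgue_stieltjes_measure.
From mathcomp Require Import ring lra.

Import Order.TTheory GRing.Theory Num.Theory.
Import numFieldNormedType.Exports.

Local Open Scope classical_set_scope.
Local Open Scope ring_scope.

Set Implicit Arguments.
Unset Strict Implicit.
Unset Printing Implicit Defensive.

(** Write Px for the law of the Levy process started at x, and Qx for the
    conditioned law. Transience of Q is proved by showing that potentials of
    small intervals are finite and that every late visit to an interval feeds
    its potential. First visits are always observed on a discrete grid of times,
    so that the Markov property at fixed times suffices.

    Upper bound. An event L decided at time t has Qx-probability at most the
    Px-integral of h(X_t) / h(x) over L ([Pud_le]). Applied to first visits to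
    a neighbourhood O of 0, this bounds the Qx-probability of ever visiting O
    by sup_O h / h(x) ([Pud_visit_le]), which is small since h is continuous
    and vanishes at 0. Before such a visit, the time spent by Q in an interval
    I is at most a multiple of the time spent there by P killed at its first
    visit to O.

    The killed potential. Observe P at an independent exponential time of
    parameter q: its law has density q u_q ([resolvent_clock_law]), and by lack
    of memory of the clock the part of the law coming after the first visit to
    O is the Laplace transform p of that visit time, times about the law started
    at 0 ([clock_law_split]). As the grid is refined and O shrinks to 0, p is at
    least about u_q(-x) / u_q(0) ([visit_laplace_ge]). So the density at y of
    the killed process is at most q times
    [(u_q(0) - u_q(y)) + (u_q(0) - u_q(-x))], up to an error. It remains to
    bound u_q(0) - u_q(-a) uniformly in q and locally uniformly in a. These
    functions of a converge pointwise, to h, and the killed density being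
    nonnegative makes them subadditive ([resolvent_subadditive]); Baire's theorem
    then gives the uniform bound ([subadditive_locally_bounded]). Hence the
    total time spent by Qx in a small interval has a finite mean
    ([potential_bounded]).

    Lower bound. Started near a point z0 with h(z0) > 0, the process stays near
    z0 during a short time with Q-probability at least 1/6 ([Pud_stays]), so by
    the Markov property the probability that Qx visits the interval after time s
    is at most a constant times the mean time spent there after s
    ([Pud_return_le]), the tail of a convergent integral. Late visits to a
    compact set are late visits to one of finitely many such intervals or to an
    arbitrarily small neighbourhood of 0 ([late_visits_null]). For the law
    started at 0, the Markov property is applied at time 1, when h is positive
    ([Pud0_shift_null]). *)

(** * Complements on measures and integrals *)

(** The integral of a nonnegative function is a supremum over the simple
    functions below it, hence monotone whether or not the functions and the
    domains are measurable, as happens with the event that 0 is not hit. *)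
Lemma ge0_le_integral_subset d (T : measurableType d) (R : realType)
    (mu : {measure set T -> \bar R}) (D E : set T) (f g : T -> \bar R) :
  (forall x, D x -> (0 <= f x)%E) -> (forall x, E x -> (0 <= g x)%E) ->
  (forall x, D x -> E x /\ (f x <= g x)%E) ->
  (\int[mu]_(x in D) f x <= \int[mu]_(x in E) g x)%E.
Proof.
move=> f0 g0 fg; rewrite !ge0_integralE//=.
apply: le_ereal_sup => _ [k /= kf <-]; exists k => //= x.
apply: (le_trans (kf x)); rewrite /patch.
case: ifPn => [/set_mem xD|_]; last by case: ifPn => [/set_mem/g0|].
by have [xE fgx] := fg x xD; rewrite ifT// inE.
Qed.

Lemma ge0_integral_mrestr d (T : measurableType d) (R : realType)
    (mu : {measure set T -> \bar R}) (D : set T) (mD : measurable D)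
    (f : T -> \bar R) :
  measurable_fun setT f -> (forall x, (0 <= f x)%E) ->
  (\int[mrestr mu mD]_x f x = \int[mu]_(x in D) f x)%E.
Proof.
move=> mf f0.
rewrite (ge0_negligible_integral (measurableC mD) measurableT mf)//; last first.
  by rewrite /= /mrestr setICl measure0.
rewrite setTD setCK; apply: eq_measure_integral => A mA AD.
by rewrite /mrestr /=; congr (mu _); exact/setIidPl.
Qed.

Lemma measure_eq_ae d (T : measurableType d) (R : realType)
    (mu : {measure set T -> \bar R}) (N A B : set T) :
  measurable N -> mu N = 0%E -> measurable A -> measurable B ->
  (forall w, ~ N w -> A w <-> B w) -> mu A = mu B.
Proof.
move=> mN N0 mA mB AB.
have h (C : set T) : measurable C -> mu C = mu (C `\` N).
  move=> mC; rewrite -[in LHS](setUIDK C N) setUC measureU0//.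
  - exact: measurableD.
  - exact: measurableI.
  - by apply: (subset_measure0 _ mN _ N0); [exact: measurableI|exact: subIsetr].
rewrite h// [RHS]h//; congr (mu _).
by apply/seteqP; split => w [wA wN]; split => //; exact/AB.
Qed.

(** * The coordinate process *)

Section coordinates.
Context {R : realType}.
Local Notation D := (cadlag_path R).
Implicit Types (w : D) (s t : R) (A : set R).

Lemma state_right_continuous w t : state w s @[s --> t^'+] --> state w t.
Proof.
have [w0 _ wr _] := path_cadlag w.
have [t0|t0] := leP 0 t.
  exact: cvg_comp (wr t t0) (@cvg_snd _ _ (nbhs (isSome (w t))) (nbhs (odflt 0 (w t))) _).
apply: cvg_near_cst; near=> s.
rewrite /state !w0//; near: s; exact: nbhs_right_lt.
Unshelve. all: by end_near. Qed.

Lemma state_right_near w t A : open A -> A (state w t) ->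
  exists2 e, 0 < e & forall s, t < s -> s < t + e -> A (state w s).
Proof.
move=> oA At; have := @state_right_continuous w t.
move=> /(_ A (open_nbhs_nbhs (conj oA At)))[/= e e0 eA]; exists e => // s ts se.
apply: eA => //=; rewrite ltr_distlC; lra.
Qed.

(** A dead path has state 0, the default value. *)
Lemma state_coord_event t A :
  [set w : D | A (state w t)] =
  coord_event t A `|` ([set _ | A 0] `\` coord_event t setT).
Proof.
apply/seteqP; split => w /=; rewrite /state.
  case E : (w t) => [x|] /= Ax; first by left; exists x.
  by right; split => // -[x]; rewrite E.
case=> [[x -> //]|[A0 n]]; case E : (w t) => [x|] //=.
by exfalso; apply: n; exists x.
Qed.

Lemma natural_filtration_sigma t : sigma_algebra setT (@natural_filtration R t).
Proof. exact: smallest_sigma_algebra. Qed.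

Lemma natural_filtration_setT t : @natural_filtration R t setT.
Proof.
have [F0 FC _] := natural_filtration_sigma t.
by rewrite -(setD0 setT); exact: FC.
Qed.

Lemma natural_filtrationC t (B : set D) :
  natural_filtration t B -> natural_filtration t (~` B).
Proof.
have [_ FC _] := natural_filtration_sigma t.
by move=> tB; rewrite -setTD; exact: FC.
Qed.

Lemma natural_filtration_bigcup t (B : (set D)^nat) :
  (forall i, natural_filtration t (B i)) -> natural_filtration t (\bigcup_i B i).
Proof. by move=> tB; have [_ _ FU] := natural_filtration_sigma t; exact: FU. Qed.

Lemma natural_filtration_bigcap t (B : (set D)^nat) :
  (forall i, natural_filtration t (B i)) -> natural_filtration t (\bigcap_i B i).
Proof.
move=> Bt; rewrite -(setCK (\bigcap_i B i)) setC_bigcap.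
apply: natural_filtrationC; apply: natural_filtration_bigcup => i.
exact: natural_filtrationC.
Qed.

Lemma natural_filtrationU t (B C : set D) : natural_filtration t B ->
  natural_filtration t C -> natural_filtration t (B `|` C).
Proof.
move=> tB tC; rewrite -bigcup2E; apply: natural_filtration_bigcup.
case=> [|[|n]] //=; have [F0 _ _] := natural_filtration_sigma t; exact: F0.
Qed.

Lemma natural_filtrationI t (B C : set D) : natural_filtration t B ->
  natural_filtration t C -> natural_filtration t (B `&` C).
Proof.
move=> tB tC; rewrite -(setCK (B `&` C)) setCI.
by apply: natural_filtrationC; apply: natural_filtrationU; exact: natural_filtrationC.
Qed.

Lemma natural_filtration_coord s t A : 0 <= s <= t -> measurable A ->
  natural_filtration t (coord_event s A).
Proof. by move=> st mA; apply: sub_sigma_algebra; exists s, A; split. Qed.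

Lemma natural_filtration_state s t A : 0 <= s <= t -> measurable A ->
  natural_filtration t [set w : D | A (state w s)].
Proof.
move=> st mA; rewrite state_coord_event; apply: natural_filtrationU.
  exact: natural_filtration_coord.
rewrite setDE; apply: natural_filtrationI.
  have [A0|nA0] := pselect (A 0).
    by rewrite (_ : [set _ | _] = setT);
      [exact: natural_filtration_setT|apply/seteqP; split].
  rewrite (_ : [set _ | _] = ~` setT).
    by apply: natural_filtrationC; exact: natural_filtration_setT.
  by rewrite setCT; apply/seteqP; split.
by apply: natural_filtrationC; exact: natural_filtration_coord.
Qed.

Lemma natural_filtration_le s t (B : set D) : s <= t ->
  natural_filtration s B -> natural_filtration t B.
Proof.
move=> st sB; apply: (sB [set C | natural_filtration t C]).
split; first exact: natural_filtration_sigma.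
move=> _ [r [A [/andP[r0 rs] mA ->]]]; apply: natural_filtration_coord => //.
by rewrite r0 (le_trans rs).
Qed.

Lemma natural_filtration_right t (B : set D) :
  natural_filtration t B -> right_filtration t B.
Proof. by move=> tB s /ltW ts; exact: natural_filtration_le tB. Qed.

Lemma natural_filtration_measurable t (B : set D) :
  natural_filtration t B -> measurable B.
Proof.
move=> tB; apply: (tB [set C | measurable C]).
split; first exact: smallest_sigma_algebra.
move=> _ [r [A [/andP[r0 rt] mA ->]]]; apply: sub_sigma_algebra.
by exists r, A; split.
Qed.

Lemma state_neg w t : state w (Num.max 0 t) = state w t.
Proof.
have [w0 _ _ _] := path_cadlag w.
rewrite /state; have [t0|t0] := leP 0 t; first by [].
by rewrite (w0 t t0).
Qed.

Lemma measurable_state_event t A : measurable A ->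
  measurable [set w : D | A (state w t)].
Proof.
move=> mA; rewrite (_ : [set _ | _] = [set w | A (state w (Num.max 0 t))]).
  apply: (@natural_filtration_measurable (Num.max 0 t)).
  by apply: natural_filtration_state; rewrite // lexx andbT le_max lexx.
by apply/seteqP; split => w /=; rewrite state_neg.
Qed.

Lemma measurable_state t : measurable_fun setT (fun w : D => state w t).
Proof. by move=> _ A mA; rewrite setTI; exact: measurable_state_event. Qed.

Lemma measurable_coord_event t A : 0 <= t -> measurable A ->
  measurable (coord_event t A : set D).
Proof.
by move=> t0 mA; apply: (@natural_filtration_measurable t);
  apply: natural_filtration_coord => //; rewrite t0 lexx.
Qed.

(* The grid point of mesh 1/(n+1) that follows t. *)
Let grid_succ n t : R := (Num.truncn (t * n.+1%:R)).+1%:R / n.+1%:R.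

Let grid_succ_gt n t : t < grid_succ n t.
Proof.
by rewrite /grid_succ ltr_pdivlMr//; apply: truncnS_gt.
Qed.

Let grid_succ_le n t : 0 <= t -> grid_succ n t <= t + n.+1%:R^-1.
Proof.
move=> t0; rewrite /grid_succ ler_pdivrMr// mulrDl mulVf// -natr1 lerD2r.
by rewrite truncn_le// mulr_ge0.
Qed.

(** By right-continuity, the state at t is the limit of the states at the grid
    points that follow t, which depend on t through a countable partition. *)
Lemma measurable_state_joint :
  measurable_fun setT (fun p : R * D => state p.2 p.1).
Proof.
apply: (@measurable_fun_cvg _ _ _ _
  (fun n (p : R * D) => state p.2 (grid_succ n (Num.max 0 p.1)))).
- move=> n _ A mA; rewrite setTI.
  pose trunc_eq k := [set t : R | Num.truncn (Num.max 0 t * n.+1%:R) = k].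
  rewrite (_ : _ @^-1` _ = \bigcup_k
      (trunc_eq k `*` [set w : D | A (state w (k.+1%:R / n.+1%:R))])).
    apply: bigcupT_measurable => k; apply: measurableX; last first.
      exact: measurable_state_event.
    rewrite (_ : trunc_eq k = (fun t : R => Num.max 0 t * n.+1%:R) @^-1`
        `[k%:R, k.+1%:R[); last first.
      apply/seteqP; split => t /=; rewrite in_itv/=; last by move=> /truncn_def.
      by move=> <-; apply: truncn_itv; rewrite mulr_ge0// le_max lexx.
    rewrite -[X in measurable X]setTI.
    apply: (@measurable_funM _ _ _ setT (fun t : R => Num.max 0 t) (cst n.+1%:R)) => //.
    by apply: (@measurable_maxr _ _ _ setT (cst 0) id).
  apply/seteqP; split => -[t w] /=; first by move=> At; exists (Num.truncn (Num.max 0 t * n.+1%:R)).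
  by move=> [k _ [/= <-]].
- move=> [t w] _ /=; rewrite -(state_neg w t).
  have t0 : 0 <= Num.max 0 t by rewrite le_max lexx.
  move: (Num.max 0 t) t0 => {}t t0.
  have h : grid_succ n t @[n --> \oo] --> t^'+.
    move=> A [/= e e0 eA]; suff : \forall n \near \oo, A (grid_succ n t) by [].
    near=> n; apply: eA => //=.
    have n1 := grid_succ_gt n t; have n2 := grid_succ_le n t0.
    have n3 : n.+1%:R^-1 < e by near: n; exact: near_infty_natSinv_lt (PosNum e0).
    move: n1 n2 n3; move: (grid_succ n t) (n.+1%:R^-1) => g i *.
    by rewrite ltr_distlC; apply/andP; split; lra.
  exact: cvg_comp h (@state_right_continuous w t).
Unshelve. all: by end_near. Qed.

End coordinates.

(** * The Markov property at a fixed time *)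

(** Fubini's theorem for a pair (X, Y) in which Y is independent of X on the
    event L: rectangles determine the joint law. *)
Lemma indep_integral d d1 d2 (T : measurableType d) (T1 : measurableType d1)
    (T2 : measurableType d2) (R : realType) (P : probability T R) (L : set T)
    (X : {mfun T >-> T1}) (Y : {mfun T >-> T2}) (C : set (T1 * T2)) :
  measurable L ->
  (forall A B, measurable A -> measurable B ->
    P (L `&` X @^-1` A `&` Y @^-1` B) = (P (L `&` X @^-1` A) * P (Y @^-1` B))%E) ->
  measurable C ->
  P (L `&` [set w | C (X w, Y w)]) =
  (\int[P]_(w in L) P (Y @^-1` (xsection C (X w))))%E.
Proof.
move=> mL XY mC.
have mX := @measurable_funPT _ _ _ _ X.
pose m1_ : {measure set T1 -> \bar R} := pushforward (mrestr P mL) X.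
pose m1 := m1_ mX.
have mXY : measurable_fun setT (fun w => (X w, Y w)) by exact: measurable_fun_pair.
pose XY' : {mfun T >-> (T1 * T2)%type} := mfun_Sub (mem_set mXY).
pose m'_ : {measure set (T1 * T2) -> \bar R} := pushforward (mrestr P mL) XY'.
pose m' := m'_ mXY.
have m'E (A : set (T1 * T2)) : m' A = P (L `&` [set w | A (X w, Y w)]).
  by rewrite /m' /m'_ /pushforward /= /mrestr setIC.
rewrite -m'E.
have -> : m' C = (m1 \x distribution P Y)%E C.
  apply: (measure_unique
    [set C | exists A B, [/\ measurable A, measurable B & C = A `*` B]]
    (fun=> setT `*` setT)) => //.
  - rewrite measurable_prod_measurableType; congr (<<s _ >>).
    by apply/seteqP; split=> [_ [A mA [B mB <-]]|_ [A [B [mA mB ->]]]]; exists A => //; exists B.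
  - move=> _ _ [A [B [mA mB ->]]] [A' [B' [mA' mB' ->]]].
    by exists (A `&` A'), (B `&` B'); rewrite setXI; split => //; exact: measurableI.
  - by move=> _; exists setT, setT.
  - by rewrite bigcup_const// setXTT.
  - move=> _ [A [B [mA mB ->]]].
    apply: etrans (esym (product_measure1E m1 (distribution P Y) mA mB)).
    rewrite m'E /= /m1 /m1_ /pushforward /= /mrestr [in RHS]setIC -XY//.
    by congr (P _); apply/seteqP; split=> w /=; tauto.
  - by move=> _; rewrite m'E (le_lt_trans (probability_le1 _ _))// ?ltry//;
      rewrite (_ : L `&` _ = L)//; apply/seteqP; split=> w //= [].
have mG := measurable_fun_xsection (distribution P Y) mC.
rewrite /product_measure1 ge0_integral_pushforward//= preimage_setT.
rewrite ge0_integral_mrestr//; exact: (measurableT_comp mG mX).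
Qed.

Section levy_markov.
Context {R : realType} (P : probability (cadlag_path R) R).
Hypothesis P_levy : levy_process P.
Local Notation D := (cadlag_path R).
Local Notation Rm := (measurableTypeR R).
Implicit Types (w : D) (s t x : R).

Lemma never_dead_ae :
  exists N : set D, [/\ measurable N, P N = 0%E &
    forall w, ~ N w -> w 0 = Some 0 /\ forall t, w t <> None].
Proof.
have [[N [mN N0 subN]] _ _] := P_levy; exists N; split => // w Nw.
have [w0 wl] : w 0 = Some 0 /\ lifetime w = +oo%E.
  by apply: contrapT => h; apply: Nw; exact: subN.
split=> // t wt.
have [wneg _ _ _] := path_cadlag w.
have [t0|t0] := leP 0 t; last by move: wt; rewrite wneg// w0.
suff : (lifetime w <= t%:E)%E by rewrite wl leye_eq.
by apply: ereal_inf_lbound; exists t.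
Qed.

Lemma state_translate x w t : w t <> None -> state (translate x w) t = x + state w t.
Proof. by rewrite /state /=; case: (w t). Qed.

Lemma law_from_state x t (A : set R) : measurable A ->
  law_from P x [set w | A (state w t)] = P [set w | A (x + state w t)].
Proof.
move=> mA; have [N [mN N0 Nalive]] := never_dead_ae.
apply: (measure_eq_ae mN N0).
- rewrite -[X in measurable X]setTI.
  exact: (measurable_translate x measurableT (measurable_state_event t mA)).
- rewrite -[X in measurable X]setTI.
  have : measurable_fun setT (fun w : D => x + state w t).
    by apply: measurable_funD => //; exact: measurable_state.
  exact.
- by move=> w /Nalive[_ wt] /=; rewrite state_translate.
Qed.

Lemma natural_filtration_translate s x (L : set D) :
  natural_filtration s L -> natural_filtration s (translate x @^-1` L).
Proof.
move=> sL; apply: (sL [set L | natural_filtration s (translate x @^-1` L)]).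
split.
  split=> /=.
  - by rewrite preimage_set0; have [] := natural_filtration_sigma s.
  - move=> A sA; rewrite setTD preimage_setC; exact: natural_filtrationC.
  - by move=> F sF; rewrite preimage_bigcup; exact: natural_filtration_bigcup.
move=> _ [r [A [rs mA ->]]] /=.
rewrite (_ : _ @^-1` _ = coord_event r (+%R x @^-1` A)).
  apply: natural_filtration_coord => //.
  by rewrite -[X in measurable X]setTI; exact: measurable_funD.
apply/seteqP; split=> w /=.
  by move=> [y]; rewrite /translate/=; case E : (w r) => [z|]//= [<-] Az; exists z.
by move=> [z /= E Az]; exists (x + z); rewrite //= E.
Qed.

Lemma measurable_law_from_state (A : set R) : measurable A ->
  measurable_fun setT (fun p : Rm * Rm => law_from P p.2 [set w | A (state w p.1)]).
Proof.
move=> mA.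
have mf : measurable_fun setT (fun p : (Rm * Rm) * D => (p.1.2 + state p.2 p.1.1 : R)).
  apply: measurable_funD => //; first by apply: measurableT_comp.
  have := @measurable_state_joint R.
  move=> /(@measurableT_comp _ _ _ _ _ _ _ _ (fun p : (Rm * Rm) * D => (p.1.1, p.2))).
  apply; apply/measurable_fun_pairP; split.
    exact: (measurableT_comp measurable_fst measurable_fst).
  exact: measurable_snd.
pose E := [set p : (Rm * Rm) * D | A (p.1.2 + state p.2 p.1.1)].
have mE : measurable E by rewrite -[E]setTI; exact: mf.
have := measurable_fun_xsection P mE.
apply: eq_measurable_fun => p _ /=; rewrite law_from_state//; congr (P _).
by apply/seteqP; split => w /=; rewrite /xsection/= inE.
Qed.

(** The increment from s to s + t is independent of the past at s and has the law
    of the position at time t. *)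
Lemma markov_fixed_time x s t (L : set D) (A : set R) : 0 <= s -> 0 <= t ->
  natural_filtration s L -> measurable A ->
  law_from P x (L `&` [set w | A (state w (s + t))]) =
  (\int[law_from P x]_(w in L) law_from P (state w s) [set w | A (state w t)])%E.
Proof.
move=> s0 t0 sL mA; have [N [mN N0 Nalive]] := never_dead_ae.
have [_ P_indep P_stat] := P_levy.
have mL := natural_filtration_measurable sL.
have sL' := @natural_filtration_translate s x L sL.
set L' := translate x @^-1` L in sL'.
have mL' := natural_filtration_measurable sL'.
pose pos w : Rm := state (translate x w) s.
pose inc w : Rm := state w (s + t) - state w s.
have mpos : measurable_fun setT pos.
  exact: (measurableT_comp (measurable_state s) (measurable_translate x)).
have minc : measurable_fun setT inc by apply: measurable_funB; exact: measurable_state.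
pose X : {mfun D >-> Rm} := mfun_Sub (mem_set mpos).
pose Y : {mfun D >-> Rm} := mfun_Sub (mem_set minc).
pose C := [set p : Rm * Rm | A (p.1 + p.2)].
have mC : measurable C.
  rewrite -[C]setTI.
  have : measurable_fun setT (fun p : Rm * Rm => (p.1 : R) + (p.2 : R)) by exact: measurable_funD.
  exact.
have XY (B B' : set Rm) : measurable B -> measurable B' ->
    P (L' `&` X @^-1` B `&` Y @^-1` B') = (P (L' `&` X @^-1` B) * P (Y @^-1` B'))%E.
  move=> mB mB'; apply: (P_indep s t _ B') => //.
  apply: natural_filtrationI => //.
  apply: (natural_filtration_translate x (L := [set w | B (state w s)])).
  by apply: natural_filtration_state => //; rewrite s0 lexx.
have YE (B : set R) : measurable B -> P (Y @^-1` B) = P [set w | B (state w t)].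
  move=> mB; rewrite (P_stat s t B)//.
  apply: (measure_eq_ae mN N0).
  - exact: measurable_coord_event.
  - exact: measurable_state_event.
  move=> w /Nalive[_ /(_ t)]; rewrite /coord_event /state /=.
  case: (w t) => [y|//] _ /=; split=> [[_ [<-]]//|By]; by exists y.
have mst : measurable [set w : D | A (state w (s + t))] by exact: measurable_state_event.
transitivity (P (L' `&` [set w | C (X w, Y w)])).
  apply: (measure_eq_ae mN N0).
  - apply: measurableI => //; rewrite -[X in measurable X]setTI.
    exact: (measurable_translate x measurableT mst).
  - apply: measurableI => //; rewrite -[X in measurable X]setTI.
    by apply: (measurable_fun_pair mpos minc).
  - move=> w /Nalive[_ wt] /=; rewrite /pos /inc !state_translate//.
    by rewrite /C /= -addrA subrKC.
rewrite (indep_integral mL' XY mC).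
have mG := measurable_law_from_state mA.
pose G (a : Rm) := law_from P a [set w | A (state w t)].
have {}mG : measurable_fun setT (fun w : D => G (state w s)).
  apply: (measurableT_comp mG (g := fun w : D => (t : Rm, state w s : Rm))).
  by apply: measurable_fun_pair => //; exact: measurable_state.
rewrite (ge0_integral_pushforward (measurable_translate x) P mL); last 2 first.
- exact: measurable_funTS.
- by [].
apply: eq_integral => w _ /=.
have mCw : measurable (xsection C (pos w)) by exact: measurable_xsection.
rewrite (YE (xsection C (pos w)) mCw) law_from_state//; congr (P _).
by apply/seteqP; split=> v /=; rewrite /xsection /= inE.
Qed.

End levy_markov.

(** * Exponential times *)

Section exponential_clock.
Context {R : realType}.
Local Notation D := (cadlag_path R).
Local Notation Rm := (measurableTypeR R).
Local Notation leb := (@lebesgue_measure R).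
Implicit Types (q : {posnum R}) (s t : R).

(** The rate carries its positivity, which makes this a probability measure for
    type inference. *)
Definition exp_clock q : probability Rm R :=
  exponential_distribution.exponential_distribution_exponential_prob__canonical__probability_measure_Probability (gt0 q).

Lemma exp_clockE q (B : set Rm) :
  exp_clock q B = (\int[leb]_(t in B) (exponential_pdf q%:num t)%:E)%E.
Proof. by []. Qed.

Lemma exp_clock_pos q (B : set Rm) : exp_clock q B =
  (\int[leb]_(t in B `&` `[0%R, +oo[) (exponential_pdf q%:num t)%:E)%E.
Proof.
rewrite exp_clockE [RHS]integral_mkcondr; apply: eq_integral => t _.
rewrite patchE; case: ifPn => //; rewrite notin_setE/= in_itv/= andbT => /negP.
by rewrite -ltNge => /lt0_exponential_pdf ->.
Qed.

Lemma lebesgue_measure_shift s (B : set Rm) : measurable B ->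
  pushforward leb (fun t : Rm => t + s : Rm) B = leb B.
Proof.
have ms : measurable_fun setT (fun t : Rm => t + s : Rm).
  by apply: measurable_funD => //; exact: measurable_id.
pose mu_ : {measure set Rm -> \bar R} := pushforward leb (fun t : Rm => t + s : Rm).
move=> mB; apply/esym/(@lebesgue_measure_unique _ (mu_ ms)) => //= _ [[a b]] _ <-.
rewrite /mu_ /pushforward /=.
rewrite (_ : _ @^-1` _ = `]a - s, b - s]%classic); last first.
  by apply/seteqP; split=> t /=; rewrite !in_itv/= ltrBlDr lerBrDr.
by rewrite !lebesgue_measure_itv/= !lte_fin ltrD2r -!EFinD opprD opprK addrACA addNr addr0.
Qed.

Lemma exp_clock_memoryless q s (B : set Rm) : 0 <= s -> measurable B ->
  exp_clock q [set t | s <= t /\ B (t - s)] = ((expR (- (q%:num * s)))%:E * exp_clock q B)%E.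
Proof.
move=> s0 mB.
have ms : measurable_fun setT (fun t : Rm => t + s : Rm).
  by apply: measurable_funD => //; exact: measurable_id.
have mE : measurable [set t : Rm | s <= t /\ B (t - s)].
  rewrite (_ : mkset _ = `[s, +oo[%classic `&` (fun t : Rm => t - s : Rm) @^-1` B); last first.
    by apply/seteqP; split=> t /=; rewrite in_itv/= andbT.
  apply: measurableI => //.
  have : measurable_fun setT (fun t : Rm => t - s : Rm).
    by apply: measurable_funB => //; exact: measurable_id.
  by move=> /(_ measurableT B mB); rewrite setTI.
have mB0 : measurable (B `&` `[0, +oo[%classic : set Rm) by exact: measurableI.
have mpdf : measurable_fun setT (fun t : Rm => (exponential_pdf q%:num t)%:E).
  by apply/measurable_EFinP; exact: measurable_exponential_pdf.
have pdf0 (t : R) : (0%E <= (exponential_pdf q%:num t)%:E)%E.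
  by rewrite lee_fin exponential_pdf_ge0.
pose mu_ : {measure set Rm -> \bar R} := pushforward leb (fun t : Rm => t + s : Rm).
rewrite [in RHS]exp_clock_pos exp_clockE.
transitivity (\int[mu_ ms]_(t in [set t : Rm | (s <= t)%R /\ B (t - s)%R]) (exponential_pdf q%:num t)%:E)%E.
  by apply: eq_measure_integral => A mA _; rewrite /= lebesgue_measure_shift.
rewrite (ge0_integral_pushforward ms)//; last exact: measurable_funTS.
rewrite -ge0_integralZl//; last exact: measurable_funTS.
rewrite (_ : _ @^-1` _ = B `&` `[0%R, +oo[%classic); last first.
  apply/seteqP; split=> t /=; rewrite in_itv/= andbT addrK lerDr; tauto.
apply: eq_integral => t; rewrite inE/= in_itv/= andbT => -[_ t0].
rewrite -EFinM !exponential_pdfE ?addr_ge0//; congr EFin.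
by rewrite mulrCA -expRD; congr (_ * expR _); rewrite mulrDr !mulNr addrC.
Qed.

Lemma ge0_integral_exp_clock_shift q s (f : Rm -> \bar R) : 0 <= s ->
  measurable_fun setT f -> (forall t, (0 <= f t)%E) ->
  (\int[exp_clock q]_(t in `[s, +oo[) f (t - s)%R =
   (expR (- (q%:num * s)))%:E * \int[exp_clock q]_t f t)%E.
Proof.
move=> s0 mf f0.
have ms : measurable_fun setT (fun t : Rm => t - s : Rm).
  by apply: measurable_funB => //; exact: measurable_id.
have mS : measurable (`[s, +oo[%classic : set Rm) by [].
pose mu_ : {measure set Rm -> \bar R} :=
  pushforward (mrestr (exp_clock q) mS) (fun t : Rm => t - s : Rm).
have e0 : 0 <= expR (- (q%:num * s)) by exact: expR_ge0.
rewrite -(@ge0_integral_mscale _ _ _ (exp_clock q) _ measurableT (NngNum e0))//.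
transitivity (\int[mu_ ms]_t f t)%E; last first.
  apply: eq_measure_integral => B mB _.
  rewrite /mu_ /= /pushforward /mrestr /mscale /= -exp_clock_memoryless//.
  congr (exp_clock q _); apply/seteqP; split=> t /=; rewrite in_itv/= andbT; tauto.
rewrite (ge0_integral_pushforward ms)// preimage_setT ge0_integral_mrestr//; first exact: measurableT_comp.
by move=> t; exact: f0.
Qed.

(** On the interval from 0 to N the density of the clock is at least
    q exp(- q N). *)
Lemma lebesgue_le_exp_clock q (N : R) (B : set Rm) : measurable B ->
  (leb (B `&` `[0%R, N]) <= (expR (q%:num * N) / q%:num)%:E * exp_clock q B)%E.
Proof.
move=> mB.
have mpdf : measurable_fun setT (fun t : Rm => (exponential_pdf q%:num t)%:E).
  by apply/measurable_EFinP; exact: measurable_exponential_pdf.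
have pdf0 (t : R) : (0%E <= (exponential_pdf q%:num t)%:E)%E.
  by rewrite lee_fin exponential_pdf_ge0.
have mBN : measurable (B `&` `[0%R, N]%classic : set Rm) by exact: measurableI.
rewrite exp_clockE -ge0_integralZl//; last exact: measurable_funTS.
rewrite -[leLHS]mul1e -(integral_cst leb mBN 1%E).
apply: ge0_le_integral_subset => //=.
  by move=> t _; rewrite mule_ge0// lee_fin divr_ge0// expR_ge0.
move=> t /=; rewrite in_itv/= => -[Bt /andP[t0 tN]]; split=> //.
rewrite -EFinM lee_fin exponential_pdfE//.
rewrite -!mulrA (mulrA _ q%:num) mulVf// mul1r -expRD -[leLHS]expR0 ler_expR.
by rewrite mulNr subr_ge0 ler_wpM2l.
Qed.

Lemma ge0_integral_le_exp_clock q (N : R) (f : Rm -> \bar R) :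
  measurable_fun setT f -> (forall t, (0 <= f t)%E) ->
  (\int[leb]_(t in `[0%R, N]) f t <=
   (expR (q%:num * N) / q%:num)%:E * \int[exp_clock q]_t f t)%E.
Proof.
move=> mf f0; have mI : measurable (`[0%R, N]%classic : set Rm) by [].
have c0 : 0 <= expR (q%:num * N) / q%:num by rewrite divr_ge0// expR_ge0.
rewrite -(ge0_integral_mrestr leb mI)//.
rewrite -(@ge0_integral_mscale _ _ _ (exp_clock q) _ measurableT (NngNum c0))//.
apply: ge0_le_measure_integral => // B mB.
exact: lebesgue_le_exp_clock.
Qed.

End exponential_clock.

Section markov_clock.
Context {R : realType} (P : probability (cadlag_path R) R).
Local Notation D := (cadlag_path R).
Local Notation Rm := (measurableTypeR R).
Local Notation leb := (@lebesgue_measure R).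
Implicit Types (q : {posnum R}) (s t x z : R) (A : set R).

(** The law of the process started at z and observed at an independent
    exponential time of parameter q: this is q times the q-resolvent kernel. *)
Definition clock_law q z A : \bar R :=
  (exp_clock q \x law_from P z)%E [set p : Rm * D | A (state p.2 p.1)].

Lemma measurable_clock_event A : measurable A ->
  measurable [set p : Rm * D | A (state p.2 p.1)].
Proof. by move=> mA; rewrite -[X in measurable X]setTI; exact: measurable_state_joint. Qed.

Lemma clock_lawE q z A : measurable A ->
  clock_law q z A = (\int[exp_clock q]_t law_from P z [set w | A (state w t)])%E.
Proof.
move=> mA; rewrite /clock_law /product_measure1; apply: eq_integral => t _ /=.
by congr (law_from P z _); apply/seteqP; split=> w; rewrite /xsection/= inE.
Qed.

Lemma resolvent_clock_law q z A (uq : R -> R) : measurable A ->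
  resolvent_density P q%:num uq ->
  clock_law q z A = (q%:num%:E * \int[leb]_(y in A) (uq (y - z))%:E)%E.
Proof.
move=> mA [_ uqP].
have mE := measurable_clock_event mA.
have mind : measurable_fun setT (\1_A : R -> R) by exact: measurable_indic.
have bnd : exists M, forall y, `|\1_A y| <= M :> R.
  by exists 1 => y; rewrite indicE ger0_norm// lern1 leq_b1.
have := uqP \1_A z mind bnd.
rewrite [X in _ = X -> _](_ : _ = \int[leb]_(y in A) (uq (y - z))%:E)%E; last first.
  rewrite [RHS]integral_mkcond; apply: eq_integral => y _.
  by rewrite patchE indicE; case: ifPn; rewrite ?mulr1// mulr0.
move=> <-.
rewrite /clock_law.
transitivity (\int[(exp_clock q \x law_from P z)%E]_p
    (\1_[set p : Rm * D | A (state p.2 p.1)] p)%:E)%E.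
  by rewrite integral_indic// setIT.
rewrite (fubini_tonelli2 (fun p => (\1_[set p : Rm * D | A (state p.2 p.1)] p)%:E))//; last first.
  by apply/measurable_EFinP; exact: measurable_indic.
rewrite /fubini_G.
have mf : measurable_fun setT (fun p : Rm * D => (expR (- (q%:num * p.1)) * \1_A (state p.2 p.1))%:E).
  apply/measurable_EFinP; apply: measurable_funM.
    apply: measurableT_comp => //; apply: measurableT_comp => //.
    exact: measurable_funM.
  exact: (measurableT_comp mind (@measurable_state_joint R)).
have f0 (p : Rm * D) : (0%R <= (expR (- (q%:num * p.1)) * \1_A (state p.2 p.1))%:E)%E.
  by rewrite lee_fin mulr_ge0// expR_ge0.
pose g (p : Rm * D) :=
  ((expR (- (q%:num * p.1)) * \1_A (state p.2 p.1))%:E * (\1_(`[0%R, +oo[) p.1)%:E)%E.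
have mg : measurable_fun setT g.
  apply: emeasurable_funM => //; apply/measurable_EFinP.
  have m1 : measurable_fun setT (\1_(`[0%R, +oo[%classic : set Rm) : Rm -> R).
    exact: measurable_indic.
  exact: (measurableT_comp m1 measurable_fst).
have g0 p : (0%R <= g p)%E by rewrite mule_ge0.
have gE w : (\int[leb]_(t in `[0%R, +oo[) (expR (- (q%:num * t)) * \1_A (state w t))%:E =
    \int[leb]_t g (t, w))%E.
  by rewrite integral_mkcond epatch_indic.
rewrite -ge0_integralZl//; first last.
- by move=> w _; apply: integral_ge0 => t _; exact: (f0 (t, w)).
- apply: (eq_measurable_fun (fun w => \int[leb]_t g (t, w))%E) => [w _|].
    by rewrite gE.
  exact: (measurable_fun_fubini_tonelli_G g mg (m1 := leb)).
apply: eq_integral => w _.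
have mAw : measurable [set t : Rm | A (state w t)].
  have := measurable_ysection w mE; congr (measurable _).
  by apply/seteqP; split => t; rewrite /ysection/= inE.
transitivity (exp_clock q [set t : Rm | A (state w t)]).
  by rewrite integral_indic// setIT.
rewrite exp_clockE -ge0_integralZl//; last first.
  apply: measurable_funTS.
  have : measurable_fun setT (fun t : Rm => (t, w)) by exact: measurable_fun_pair.
  exact: (measurableT_comp mf).
rewrite [LHS]integral_mkcond [RHS]integral_mkcond; apply: eq_integral => t _.
rewrite !patchE indicE mem_setE.
have [t0|t0] := leP 0 t.
  rewrite [in RHS]ifT; last by rewrite in_itv/= t0.
  rewrite [in RHS](_ : (state w t \in A) = (t \in [set t | A (state w t)])); last first.
    by apply/idP/idP; rewrite !inE.
  by case: ifPn => _; rewrite ?mulr1 ?mulr0 ?mule0// exponential_pdfE// mulNr.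
rewrite [in RHS]ifF; last by rewrite in_itv/= andbT leNgt t0.
by rewrite lt0_exponential_pdf//; case: ifP.
Qed.

Hypothesis P_levy : levy_process P.

(** Given that the clock has not rung before s, its remaining time is again
    exponential and independent of the process, to which the Markov property at
    time s applies. *)
Lemma markov_clock q x s (L : set D) A : 0 <= s ->
  natural_filtration s L -> measurable A ->
  (exp_clock q \x law_from P x)%E
    [set p : Rm * D | [/\ s <= p.1, L p.2 & A (state p.2 p.1)]] =
  ((expR (- (q%:num * s)))%:E *
   \int[law_from P x]_(w in L) clock_law q (state w s) A)%E.
Proof.
move=> s0 sL mA; have mL := natural_filtration_measurable sL.
pose G t z := law_from P z [set w | A (state w t)].
have mG : measurable_fun setT (fun p : Rm * Rm => G p.1 p.2).
  exact: (measurable_law_from_state P_levy mA).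
pose F (p : Rm * D) := (G p.1 (state p.2 s) * (\1_L p.2)%:E)%E.
have F0 p : (0%R <= F p)%E by rewrite mule_ge0.
have mF : measurable_fun setT F.
  apply: emeasurable_funM.
    apply: (measurableT_comp mG (g := fun p : Rm * D => (p.1, state p.2 s : Rm))).
    apply: measurable_fun_pair => //.
    exact: (measurableT_comp (measurable_state s) measurable_snd).
  by apply/measurable_EFinP; apply: measurableT_comp => //; exact: measurable_indic.
have FE t : (\int[law_from P x]_w F (t, w) =
    \int[law_from P x]_(w in L) G t (state w s))%E.
  by rewrite [RHS]integral_mkcond epatch_indic.
transitivity (\int[exp_clock q]_(t in `[s, +oo[)
    \int[law_from P x]_w F (t - s, w)%R)%E.
  rewrite /product_measure1 [RHS]integral_mkcond; apply: eq_integral => t _ /=.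
  rewrite patchE; case: ifPn; rewrite ?notin_setE ?inE /= in_itv/= andbT => st.
    rewrite FE /G -(markov_fixed_time P_levy x s0 _ sL mA) ?subr_ge0//.
    congr (law_from P x _); apply/seteqP; split=> w; rewrite /xsection/= inE/= subrKC.
      by case.
    by case=> Lw Aw; split.
  rewrite [X in law_from P x X](_ : _ = set0) ?measure0//.
  by apply/seteqP; split=> w //=; rewrite /xsection/= inE/= => -[st'].
have mFt := measurable_fun_fubini_tonelli_F F mF (m2 := law_from P x).
rewrite (ge0_integral_exp_clock_shift q s0 (mFt F0)); last first.
  by move=> t; apply: integral_ge0 => w _; exact: F0.
congr (_ * _)%E.
rewrite (fubini_tonelli F mF F0) [RHS]integral_mkcond epatch_indic.
apply: eq_integral => w _.
rewrite clock_lawE// -ge0_integralZr//; last by rewrite lee_fin.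
apply: (measurableT_comp mG (g := fun t : Rm => (t, state w s : Rm))).
exact: measurable_fun_pair.
Qed.

End markov_clock.

(** * First visits on a grid of times *)

Section grid.
Context {R : realType}.
Local Notation D := (cadlag_path R).
Local Notation Rm := (measurableTypeR R).
Implicit Types (s d t : R) (O A : set R).

Definition grid s d (j : nat) : R := s + j%:R * d.

Definition visit O s d (j : nat) : set D := [set w | O (state w (grid s d j))].

Definition first_visit O s d : (set D)^nat := seqDU (visit O s d).

Lemma grid_ge0 s d j : 0 <= s -> 0 <= d -> 0 <= grid s d j.
Proof. by move=> s0 d0; rewrite addr_ge0// mulr_ge0. Qed.

Lemma grid_le s d i j : 0 <= d -> (i <= j)%N -> grid s d i <= grid s d j.
Proof. by move=> d0 ij; rewrite lerD2l ler_wpM2r// ler_nat. Qed.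

(** By right-continuity the path stays in O for some time after t, and this lapse
    of time contains a point of every fine enough grid. *)
Lemma grid_visit O s t (w : D) : open O -> s <= t -> O (state w t) ->
  forall r, t < r -> \forall n \near \oo,
    exists2 j, t < grid s n.+1%:R^-1 j < r & O (state w (grid s n.+1%:R^-1 j)).
Proof.
move=> oO st Ot r tr; have [e e0 eO] := state_right_near oO Ot.
have m0 : 0 < Num.min e (r - t) by rewrite lt_min e0 subr_gt0.
near=> n.
have nm : n.+1%:R^-1 < Num.min e (r - t).
  by near: n; exact: near_infty_natSinv_lt (PosNum m0).
move: nm; rewrite lt_min => /andP[ne nr].
pose j := (Num.truncn ((t - s) * n.+1%:R)).+1.
have j1 : t < grid s n.+1%:R^-1 j.
  by rewrite /grid -ltrBlDl ltr_pdivlMr//; exact: truncnS_gt.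
have j2 : grid s n.+1%:R^-1 j <= t + n.+1%:R^-1.
  rewrite /grid /j -(natr1 (Num.truncn _)) mulrDl mul1r addrA lerD2r -lerBrDl ler_pdivrMr//.
  by rewrite truncn_le// mulr_ge0// subr_ge0.
have j3 : grid s n.+1%:R^-1 j < r by rewrite (le_lt_trans j2)// -ltrBrDl.
exists j; first by rewrite j1.
by apply: eO => //; rewrite (le_lt_trans j2)// ltrD2l.
Unshelve. all: by end_near. Qed.

Lemma natural_filtration_visit O s d j : 0 <= s -> 0 <= d -> measurable O ->
  forall k, (j <= k)%N -> natural_filtration (grid s d k) (visit O s d j).
Proof.
move=> s0 d0 mO k jk; apply: natural_filtration_state => //.
by rewrite grid_ge0//= grid_le.
Qed.

Lemma natural_filtration_first_visit O s d j : 0 <= s -> 0 <= d -> measurable O ->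
  natural_filtration (grid s d j) (first_visit O s d j).
Proof.
move=> s0 d0 mO; rewrite /first_visit /seqDU setDE.
apply: natural_filtrationI; first exact: natural_filtration_visit.
apply: natural_filtrationC; apply: big_ind => [|B C|i _].
- by have [] := natural_filtration_sigma (grid s d j).
- exact: natural_filtrationU.
- by apply: natural_filtration_visit => //; exact: ltnW.
Qed.

Lemma measurable_first_visit O s d j : 0 <= s -> 0 <= d -> measurable O ->
  measurable (first_visit O s d j).
Proof.
by move=> s0 d0 mO; apply: natural_filtration_measurable;
  exact: natural_filtration_first_visit.
Qed.

Lemma first_visit_visit O s d j w : first_visit O s d j w -> O (state w (grid s d j)).
Proof. exact: (@subset_seqDU _ (visit O s d)). Qed.

Definition unvisited O s d t : set D :=
  [set w | forall j, grid s d j <= t -> ~ O (state w (grid s d j))].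

Lemma unvisited_setC O s d t w : 0 <= d -> ~ unvisited O s d t w <->
  exists2 j, grid s d j <= t & first_visit O s d j w.
Proof.
move=> d0; split=> [/existsNP[j] /not_implyP[jt /contrapT Oj]|[j jt /first_visit_visit Oj] /(_ j jt)//].
have : (\bigcup_(k < j.+1) visit O s d k) w by exists j => //=.
rewrite bigcup_mkord bigsetU_seqDU -bigcup_mkord => -[k /= kj wk].
by exists k => //; apply: le_trans jt; exact: grid_le.
Qed.

Lemma natural_filtration_unvisited O s d t : 0 <= s -> 0 <= d -> measurable O ->
  natural_filtration t (unvisited O s d t).
Proof.
move=> s0 d0 mO.
rewrite (_ : unvisited O s d t = \bigcap_j
    (if grid s d j <= t then ~` visit O s d j else setT)).
  apply: natural_filtration_bigcap => j; case: ifPn => jt.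
    by apply: natural_filtrationC; apply: natural_filtration_state => //; rewrite grid_ge0.
  exact: natural_filtration_setT.
apply/seteqP; split=> w /= h j; first by move=> _; case: ifPn => // jt; exact: h.
by move=> jt; have := h j Logic.I; rewrite jt.
Qed.

Lemma measurable_unvisited_joint O s d : measurable O ->
  measurable [set p : Rm * D | unvisited O s d p.1 p.2].
Proof.
move=> mO; rewrite (_ : mkset _ = \bigcap_j
    ((`]-oo, grid s d j[%classic `*` setT) `|` (setT `*` ~` visit O s d j))).
  apply: bigcap_measurable => // j _; apply: measurableU.
    exact: measurableX.
  by apply: measurableX => //; apply: measurableC; exact: measurable_state_event.
apply/seteqP; split=> -[t w] /= h j.
  move=> _ /=; rewrite in_itv/=; case: (leP (grid s d j) t) => jt; last by left.
  by right; split=> //; exact: h.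
move=> jt; have [[]|[]//] := h j Logic.I.
by rewrite /= in_itv/= ltNge jt.
Qed.

End grid.

Section clock_split.
Context {R : realType} (P : probability (cadlag_path R) R).
Hypothesis P_levy : levy_process P.
Local Notation D := (cadlag_path R).
Local Notation Rm := (measurableTypeR R).
Implicit Types (q : {posnum R}) (s d t x z : R) (A O : set R).

(** Up to the factor q, the q-resolvent kernel of the process killed when the
    grid finds it in O. *)
Definition killed_clock_law q z O s d A : \bar R :=
  (exp_clock q \x law_from P z)%E
    [set p : Rm * D | unvisited O s d p.1 p.2 /\ A (state p.2 p.1)].

(** The Laplace transform at q of the time of the first visit to O on the grid,
    which is also the probability that this visit precedes the clock. *)
Definition visit_laplace q z O s d : \bar R :=
  (\sum_(j <oo) (expR (- (q%:num * grid s d j)))%:E *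
    law_from P z (first_visit O s d j))%E.

(** Either O is unvisited when the clock rings, or exactly one of the events of a
    first visit at a given grid time before the clock has occurred, and the
    process restarts from there. *)
Lemma clock_law_split q z O s d A : 0 <= s -> 0 <= d ->
  measurable O -> measurable A ->
  clock_law P q z A = (killed_clock_law q z O s d A +
    \sum_(j <oo) (expR (- (q%:num * grid s d j)))%:E *
      \int[law_from P z]_(w in first_visit O s d j) clock_law P q (state w (grid s d j)) A)%E.
Proof.
move=> s0 d0 mO mA.
pose V := [set p : Rm * D | unvisited O s d p.1 p.2 /\ A (state p.2 p.1)].
pose F j := [set p : Rm * D |
  [/\ grid s d j <= p.1, first_visit O s d j p.2 & A (state p.2 p.1)]].
have mE := measurable_clock_event mA.
have mV : measurable V by apply: measurableI => //; exact: measurable_unvisited_joint.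
have mF j : measurable (F j).
  rewrite (_ : F j = (`[grid s d j, +oo[%classic `*` first_visit O s d j) `&`
      [set p : Rm * D | A (state p.2 p.1)]).
    by apply: measurableI => //; apply: measurableX => //; exact: measurable_first_visit.
  by apply/seteqP; split=> -[t w] /=; rewrite in_itv/= andbT /F/=; [case=> ? ? ?|case=> -[]].
have tF : trivIset setT F.
  move=> i j _ _ [[t w] [[_ /= wi _] [_ wj _]]].
  by apply: (trivIset_seqDU (visit O s d)) => //; exists w.
rewrite [LHS]/clock_law [X in _ X = _](_ : _ = V `|` \bigcup_j F j); last first.
  apply/seteqP; split=> -[t w] /=.
    move=> Atw; have [?|] := pselect (unvisited O s d t w); first by left.
    by move=> /(unvisited_setC O s t w d0)[j jt wj]; right; exists j.
  by case=> [[]|[j _ []]].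
rewrite measureU//; last 2 first.
- exact: bigcupT_measurable.
- apply/seteqP; split=> -[t w] //= [[uv _] [j _ [/= jt wj _]]].
  have /(unvisited_setC O s t w d0) : exists2 k, grid s d k <= t & first_visit O s d k w.
    by exists j.
  exact.
congr (_ + _)%E.
have mUF : measurable (\bigcup_j F j) by exact: bigcupT_measurable.
apply: etrans (measure_semi_bigcup (exp_clock q \x law_from P z)%E mF tF mUF) _.
apply: eq_eseriesr => j _.
apply: (markov_clock P_levy q z (grid_ge0 j s0 d0) _ mA).
exact: natural_filtration_first_visit.
Qed.

Lemma clock_law_setT q z : clock_law P q z setT = 1%E.
Proof. by rewrite /clock_law (_ : mkset _ = setT) ?probability_setT//; apply/seteqP. Qed.

Lemma visit_laplace_ge0 q z O s d : (0 <= visit_laplace q z O s d)%E.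
Proof. by apply: nneseries_ge0 => j _ _; rewrite mule_ge0// lee_fin expR_ge0. Qed.

Lemma integral_first_visit_cst z O s d j (m : \bar R) : 0 <= s -> 0 <= d -> measurable O ->
  (\int[law_from P z]_(w in first_visit O s d j) m = m * law_from P z (first_visit O s d j))%E.
Proof. by move=> s0 d0 mO; rewrite (integral_cst (law_from P z))//; exact: measurable_first_visit. Qed.

Lemma visit_laplace_le1 q z O s d : 0 <= s -> 0 <= d -> measurable O ->
  (visit_laplace q z O s d <= 1)%E.
Proof.
move=> s0 d0 mO; rewrite -(clock_law_setT q z).
rewrite (clock_law_split q z s0 d0 mO measurableT).
apply: le_trans (leeDr _ (measure_ge0 _ _)).
rewrite le_eqVlt; apply/orP; left; apply/eqP.
apply: eq_eseriesr => j _; congr (_ * _)%E.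
under eq_integral do rewrite clock_law_setT.
by rewrite integral_first_visit_cst// mul1e.
Qed.

Lemma clock_law_le q z O s d A (M : R) : 0 <= s -> 0 <= d ->
  measurable O -> measurable A -> 0 <= M ->
  (forall y, O y -> clock_law P q y A <= M%:E)%E ->
  (clock_law P q z A <= killed_clock_law q z O s d A + M%:E * visit_laplace q z O s d)%E.
Proof.
move=> s0 d0 mO mA M0 OM; rewrite (clock_law_split q z s0 d0 mO mA) leeD2l//.
rewrite -nneseriesZl; last by move=> j _; rewrite mule_ge0// lee_fin expR_ge0.
apply: lee_nneseries => [j _ _|j _].
  by rewrite mule_ge0// ?lee_fin ?expR_ge0// integral_ge0.
rewrite muleCA lee_wpmul2l// ?lee_fin ?expR_ge0//.
rewrite -(integral_first_visit_cst z j M%:E s0 d0 mO).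
by apply: ge0_le_integral_subset => // w wj; split => //; apply: OM; exact: first_visit_visit wj.
Qed.

Lemma clock_law_ge q z O s d A (m : R) : 0 <= s -> 0 <= d ->
  measurable O -> measurable A -> 0 <= m ->
  (forall y, O y -> m%:E <= clock_law P q y A)%E ->
  (killed_clock_law q z O s d A + m%:E * visit_laplace q z O s d <= clock_law P q z A)%E.
Proof.
move=> s0 d0 mO mA M0 OM; rewrite (clock_law_split q z s0 d0 mO mA) leeD2l//.
rewrite -nneseriesZl; last by move=> j _; rewrite mule_ge0// lee_fin expR_ge0.
apply: lee_nneseries => [j _ _|j _].
  by rewrite mule_ge0// ?lee_fin// mule_ge0// lee_fin expR_ge0.
rewrite muleCA lee_wpmul2l// ?lee_fin ?expR_ge0//.
rewrite -(integral_first_visit_cst z j m%:E s0 d0 mO).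
by apply: ge0_le_integral_subset => // w wj; split => //; apply: OM; exact: first_visit_visit wj.
Qed.

(** As the mesh tends to 0 with O open, the clock can only ring in O, without O
    having been visited on the grid, at the very first time spent in O; that is
    a single instant, which a clock with a density misses. *)
Lemma killed_clock_law_cvg0 q z O : open O ->
  killed_clock_law q z O 0 n.+1%:R^-1 O @[n --> \oo] --> 0%E.
Proof.
move=> oO; have mO : measurable O by exact: open_measurable.
pose S n := [set p : Rm * D | unvisited O 0 n.+1%:R^-1 p.1 p.2 /\ O (state p.2 p.1)].
have mS n : measurable (S n).
  by apply: measurableI; [exact: measurable_unvisited_joint|exact: measurable_clock_event].
pose mu := (exp_clock q \x law_from P z)%E.
have lim0 : mu (lim_sup_set S) = 0%E.
  have mlim : measurable (lim_sup_set S).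
    by apply: bigcap_measurable => // n _; exact: bigcup_measurable.
  transitivity (\int[mu]_p (\1_(lim_sup_set S) p)%:E)%E.
    by rewrite integral_indic// setIT.
  rewrite (fubini_tonelli2 (fun p => (\1_(lim_sup_set S) p)%:E))//; last first.
    by apply/measurable_EFinP; exact: measurable_indic.
  apply: integral0_eq => w _; rewrite /fubini_G.
  pose B := ysection (lim_sup_set S) w.
  have mB : measurable B by exact: measurable_ysection.
  transitivity (exp_clock q B).
    rewrite -[in RHS](setIT B) -integral_indic//; apply: eq_integral => t _.
    by rewrite !indicE /B mem_ysection.
  rewrite exp_clock_pos.
  suff [t0 Bt0] : exists t0, B `&` `[0, +oo[%classic `<=` [set t0].
    by rewrite (integral_Sset1 _ Bt0).
  have first t r : 0 <= t -> B t -> O (state w t) -> B r -> r <= t.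
    move=> t0 Bt Ot Br; rewrite leNgt; apply/negP => tr.
    have [N _ Ngrid] := grid_visit oO t0 Ot tr.
    move: Br; rewrite /B /ysection /= inE => /(_ N Logic.I)[n /= Nn [/= uv _]].
    by have [j /andP[_ jr] Oj] := Ngrid n Nn; exact: uv (ltW jr) Oj.
  have BO t : B t -> O (state w t).
    by rewrite /B /ysection /= inE => /(_ 0%N Logic.I)[n _ []].
  have [[t0 [Bt0 t00]]|B0] := pselect (exists t, B t /\ 0 <= t).
    exists t0 => t [/= Bt]; rewrite in_itv/= andbT => t0'.
    apply/eqP; rewrite eq_le.
    by rewrite (first t0 t t00 Bt0 (BO _ Bt0) Bt) (first t t0 t0' Bt (BO _ Bt) Bt0).
  exists 0 => t [/= Bt]; rewrite in_itv/= andbT => t0'.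
  by exfalso; apply: B0; exists t.
have cvgU : mu (\bigcup_(k >= n) S k) @[n --> \oo] --> 0%E.
  rewrite -lim0; apply: lim_sup_set_cvg => //.
  have m0 : measurable (\bigcup_(k >= 0) S k) by exact: bigcup_measurable.
  by rewrite (le_lt_trans (probability_le1 mu m0))// ltry.
apply: (squeeze_cvge _ (cvg_cst 0%E) cvgU).
near=> n; apply/andP; split; first exact: measure_ge0.
apply: le_measure; rewrite ?inE.
- exact: mS.
- exact: bigcup_measurable.
- by move=> p Sp; exists n => /=.
Unshelve. all: by end_near. Qed.

End clock_split.

(** * The resolvent density *)

Lemma continuous_near (R : realType) (f : R -> R) (a e : R) :
  continuous f -> 0 < e -> exists2 r, 0 < r &
    forall y, a - r < y < a + r -> f a - e < f y < f a + e.
Proof.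
move=> cf e0; have := cf a.
move=> /cvgrPdist_lt /(_ e e0)[/= r r0 H]; exists r => // y /andP[y1 y2].
by rewrite -ltr_distl distrC; apply: H; rewrite /= ltr_distlC; apply/andP; split; lra.
Qed.

Section resolvent_density.
Context {R : realType} (P : probability (cadlag_path R) R).
Hypothesis P_levy : levy_process P.
Variables (q : {posnum R}) (uq : R -> R).
Hypothesis uqP : resolvent_density P q%:num uq.
Local Notation D := (cadlag_path R).
Local Notation Rm := (measurableTypeR R).
Local Notation leb := (@lebesgue_measure R).
Local Notation itv a e := (`]a - e, a + e[%classic : set R).
Implicit Types (x y z a e m : R).

Let uq_continuous : continuous uq. Proof. by have [] := uqP. Qed.

Let leb_itv a e : 0 < e -> leb (itv a e) = (2 * e)%:E.
Proof.
move=> e0; rewrite lebesgue_measure_itv/= lte_fin ifT; last by lra.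
by rewrite -EFinB; congr EFin; lra.
Qed.

(** A negative value would persist on a small interval, which would then have a
    negative probability at the exponential clock. *)
Lemma resolvent_density_ge0 a : 0 <= uq a.
Proof.
rewrite leNgt; apply/negP => a0.
have e0 : 0 < - (uq a / 2) by lra.
have [r r0 h] := continuous_near a uq_continuous e0.
have mI : measurable (itv a r : set R) by [].
have : (0 <= clock_law P q 0 (itv a r))%E by exact: measure_ge0.
rewrite (resolvent_clock_law 0 mI uqP) leNgt => /negP; apply.
rewrite pmule_rlt0 ?lte_fin//.
under eq_integral do rewrite -[X in X%:E]opprK EFinN.
rewrite integral_ge0N; last first.
  by move=> y; rewrite /= in_itv/= subr0 lee_fin => /h/andP[_]; lra.
have : (0 < \int[leb]_(y in itv a r) (- (uq a / 2))%:E)%E.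
  rewrite (integral_cst leb mI) [X in (_ * X)%E](leb_itv a r0) -EFinM lte_fin.
  by rewrite mulr_gt0// mulr_gt0.
rewrite oppe_lt0 => /lt_le_trans; apply.
apply: ge0_le_integral_subset => y; rewrite /= in_itv/= ?subr0 ?lee_fin.
- by lra.
- by move/h => /andP[_]; lra.
- by move=> /[dup] yI /h/andP[_]; rewrite ?lee_fin => ?; split=> //; lra.
Qed.

Lemma clock_law_itv_ge z a e m : 0 < e -> 0 <= m ->
  (forall y, a - e < y < a + e -> m <= uq (y - z)) ->
  ((q%:num * (2 * e * m))%:E <= clock_law P q z (itv a e))%E.
Proof.
move=> e0 m0 h; have mI : measurable (itv a e : set R) by [].
rewrite (resolvent_clock_law z mI uqP) EFinM lee_pmul2l// mulrC EFinM.
rewrite -[X in (_ * X)%E](leb_itv a e0) -(integral_cst leb mI).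
apply: ge0_le_integral_subset => y; rewrite /= in_itv/= ?lee_fin//.
- by move=> _; exact: resolvent_density_ge0.
- by move=> yI; split=> //; exact: h.
Qed.

Lemma clock_law_itv_le z a e m : 0 < e -> 0 <= m ->
  (forall y, a - e < y < a + e -> uq (y - z) <= m) ->
  (clock_law P q z (itv a e) <= (q%:num * (2 * e * m))%:E)%E.
Proof.
move=> e0 m0 h; have mI : measurable (itv a e : set R) by [].
rewrite (resolvent_clock_law z mI uqP) EFinM lee_pmul2l// [in leRHS]mulrC EFinM.
rewrite -[X in (_ * X)%E](leb_itv a e0) -(integral_cst leb mI).
apply: ge0_le_integral_subset => y; rewrite /= in_itv/= ?lee_fin//.
- by move=> _; exact: resolvent_density_ge0.
- by move=> yI; split=> //; exact: h.
Qed.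

(** Started at x, the occupation density at 0 is produced after the first visit
    to a neighbourhood of 0, from where it is about uq 0: this bounds the
    Laplace transform of that visit time from below. *)
Lemma visit_laplace_ge x e : 0 < e -> exists2 r0, 0 < r0 &
  forall r, 0 < r -> r < r0 -> exists n p, [/\
    visit_laplace P q x (itv 0 r) 0 n.+1%:R^-1 = p%:E, 0 <= p, p <= 1 &
    uq (- x) - e <= p * (uq 0 + e)].
Proof.
move=> e0; have e20 : 0 < e / 2 by lra.
have [r1 r10 h1] := continuous_near (- x) uq_continuous e20.
have [r2 r20 h2] := continuous_near 0 uq_continuous e20.
exists (Num.min r1 (r2 / 2)); first by rewrite lt_min r10; lra.
move=> r r0; rewrite lt_min => /andP[rr1 rr2].
have oI : open (itv 0 r : set R) by exact: interval_open.
have mI : measurable (itv 0 r : set R) by [].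
have [n /= Vn] : exists n,
    (killed_clock_law P q x (itv 0 r) 0 n.+1%:R^-1 (itv 0 r) < (q%:num * (r * e))%:E)%E.
  have c0 : (0 < (q%:num * (r * e))%:E)%E by rewrite lte_fin !mulr_gt0.
  have := killed_clock_law_cvg0 P q x oI.
  have nb := open_nbhs_nbhs (conj (@open_ereal_lt_ereal _ (q%:num * (r * e))%:E) c0).
  move=> /(_ _ nb)[n _ /(_ n (leqnn n)) h].
  by exists n.
have [p pE] : exists p, visit_laplace P q x (itv 0 r) 0 n.+1%:R^-1 = p%:E.
  exists (fine (visit_laplace P q x (itv 0 r) 0 n.+1%:R^-1)); rewrite fineK//.
  rewrite ge0_fin_numE ?visit_laplace_ge0//.
  by rewrite (le_lt_trans (visit_laplace_le1 P_levy q x _ _ mI))// ltry.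
have p0 : 0 <= p by rewrite -lee_fin -pE visit_laplace_ge0.
have p1 : p <= 1 by rewrite -lee_fin -pE (visit_laplace_le1 P_levy).
exists n, p; split => //.
have u0 := resolvent_density_ge0 0.
have lo : ((q%:num * (2 * r * Num.max 0 (uq (- x) - e / 2)))%:E <=
    clock_law P q x (itv 0 r))%E.
  apply: clock_law_itv_ge => //; first by rewrite le_max lexx.
  move=> y yr; rewrite ge_max resolvent_density_ge0/=.
  by have /h1/andP[/ltW] : - x - r1 < y - x < - x + r1 by apply/andP; split; lra.
have M0 : 0 <= q%:num * (2 * r * (uq 0 + e / 2)).
  by rewrite !mulr_ge0//; lra.
have up : (clock_law P q x (itv 0 r) <= (q%:num * (r * e))%:E +
    (q%:num * (2 * r * (uq 0 + e / 2)))%:E * p%:E)%E.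
  have d0 : 0 <= n.+1%:R^-1 :> R by rewrite invr_ge0.
  have := clock_law_le (q := q) P_levy x (lexx 0) d0 mI mI M0.
  rewrite -pE => H; apply: (le_trans (H _)).
    move=> z; rewrite /= in_itv/= => zr.
    apply: clock_law_itv_le => //; first lra.
    move=> y yr.
    by have /h2/andP[_ /ltW] : 0 - r2 < y - z < 0 + r2 by apply/andP; split; lra.
  by rewrite leeD2r// ltW.
have := le_trans lo up; rewrite -EFinM -EFinD lee_fin.
have -> : q%:num * (r * e) + q%:num * (2 * r * (uq 0 + e / 2)) * p =
    q%:num * (2 * r * (e / 2 + (uq 0 + e / 2) * p)) by field.
rewrite ler_pM2l// ler_pM2l; last lra.
rewrite ge_max => /andP[_]; nra.
Qed.

(** The Laplace transform bounded below by [visit_laplace_ge] is at most 1. *)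
Lemma resolvent_density_le0 x : uq x <= uq 0.
Proof.
apply/ler_addgt0Pl => e e0; have e20 : 0 < e / 2 by lra.
have [r0 r00 h] := visit_laplace_ge (- x) e20.
have [n [p [_ p0 p1]]] := h (r0 / 2) ltac:(lra) ltac:(lra).
by rewrite opprK; have := resolvent_density_ge0 0; nra.
Qed.

(** The process started at x occupies y at least by visiting 0 first: the left
    hand side divided by uq 0 is the occupation density at y after that visit. *)
Lemma resolvent_density_mul x y : uq (- x) * uq y <= uq (y - x) * uq 0.
Proof.
have u0 := resolvent_density_ge0.
apply/ler_addgt0Pl => e e0.
have c0 : 0 < uq y + 2 * uq 0 + uq (y - x) + 3 by have := u0 y; have := u0 0; have := u0 (y - x); lra.
pose k := Num.min 1 (e / (uq y + 2 * uq 0 + uq (y - x) + 3)).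
have k0 : 0 < k by rewrite lt_min ltr01 divr_gt0.
have k1 : k <= 1 by rewrite ge_min lexx.
have k2 : k * (uq y + 2 * uq 0 + uq (y - x) + 3) <= e.
  by rewrite -ler_pdivlMr// ge_min lexx orbT.
have [r1 r10 h1] := continuous_near (y - x) uq_continuous k0.
have [r2 r20 h2] := continuous_near y uq_continuous k0.
have [r0 r00 h] := visit_laplace_ge x k0.
pose r := Num.min (r0 / 2) (r2 / 2).
have r'0 : 0 < r by rewrite lt_min; apply/andP; split; lra.
have rr0 : r < r0 by rewrite gt_min; apply/orP; left; lra.
have rr2 : r <= r2 / 2 by rewrite ge_min lexx orbT.
have [n [p [pE p0 p1 hp]]] := h r r'0 rr0.
pose s := Num.min r1 (r2 / 2).
have s0 : 0 < s by rewrite lt_min r10; lra.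
have sr1 : s <= r1 by rewrite ge_min lexx.
have sr2 : s <= r2 / 2 by rewrite ge_min lexx orbT.
have mI a b : measurable (itv a b : set R) by [].
have m0 : 0 <= q%:num * (2 * s * Num.max 0 (uq y - k)).
  by rewrite !mulr_ge0 ?le_max ?lexx//; lra.
have lo : ((q%:num * (2 * s * Num.max 0 (uq y - k)))%:E * p%:E <=
    clock_law P q x (itv y s))%E.
  have d0 : 0 <= n.+1%:R^-1 :> R by rewrite invr_ge0.
  have := clock_law_ge (q := q) P_levy x (lexx 0) d0 (mI 0 r) (mI y s) m0.
  rewrite -pE => H; apply: le_trans (H _); first by rewrite leeDr// measure_ge0.
  move=> z; rewrite /= in_itv/= => zr.
  apply: clock_law_itv_ge => //; first by rewrite le_max lexx.
  move=> y' yr; rewrite ge_max u0/=.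
  by have /h2/andP[/ltW] : y - r2 < y' - z < y + r2 by apply/andP; split; lra.
have up : (clock_law P q x (itv y s) <= (q%:num * (2 * s * (uq (y - x) + k)))%:E)%E.
  apply: clock_law_itv_le => //; first by have := u0 (y - x); lra.
  move=> y' yr.
  by have /h1/andP[_ /ltW] : y - x - r1 < y' - x < y - x + r1 by apply/andP; split; lra.
have := le_trans lo up; rewrite -EFinM lee_fin -!mulrA ler_pM2l// ler_pM2l// ler_pM2l// => H.
have H' : (uq y - k) * p <= uq (y - x) + k.
  by apply: le_trans H; rewrite ler_wpM2r// le_max lexx orbT.
have H2 : p * uq y <= uq (y - x) + 2 * k by nra.
have H3 : (uq (- x) - k) * uq y <= (uq 0 + k) * (p * uq y).
  by rewrite mulrA ler_wpM2r// mulrC.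
have H4 : (uq 0 + k) * (p * uq y) <= (uq 0 + k) * (uq (y - x) + 2 * k).
  by rewrite ler_wpM2l//; have := u0 0; lra.
have k3 : k * k <= k by rewrite ger_pMr.
move: H3 H4 k2; lra.
Qed.

(** With c = uq 0, A = uq (- a), B = uq (- b) and C = uq (- (a + b)), one has
    A B <= C c by [resolvent_density_mul], and A + B - c <= A B / c because A and
    B are at most c. *)
Lemma resolvent_subadditive a b :
  uq 0 - uq (- (a + b)) <= (uq 0 - uq (- a)) + (uq 0 - uq (- b)).
Proof.
have := resolvent_density_mul a (- b); rewrite -opprD addrC.
have := resolvent_density_ge0 (- (a + b)); have := resolvent_density_ge0 0.
have := resolvent_density_le0 (- a); have := resolvent_density_le0 (- b).
move: (uq 0) (uq (- a)) (uq (- b)) (uq (- (a + b))) => c A B C.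
move=> Bc Ac c0 C0 H.
have [c00|c0'] := leP c 0; first lra.
rewrite -(ler_pM2r c0'); nra.
Qed.

End resolvent_density.

(** * Families of subadditive functions *)

(** Baire's theorem gives a bound that is uniform on some interval, and
    subadditivity translates it anywhere. *)
Lemma subadditive_locally_bounded (R : realType) (v : nat -> R -> R) :
  (forall j, continuous (v j)) ->
  (forall j a b, v j (a + b) <= v j a + v j b) ->
  (forall a, exists M, forall j, v j a <= M) ->
  forall a, exists M r, 0 < r /\
    forall j y, a - r < y < a + r -> v j y <= M.
Proof.
move=> vc vD vb a.
pose F i : set R^o := \bigcup_j [set y | i%:R < v j y].
have oF i : open (F i).
  apply: bigcup_open => j _; apply: (open_comp (f := v j) (D := [set y | i%:R < y])).
    by move=> y _; exact: vc.
  exact: open_gt.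
have [i ndF] : exists i, ~ dense (F i).
  apply: contrapT => /forallNP dF.
  have /(_ setT) [||y [_ Fy]] := @Baire _ R^o F (fun i => conj (oF i) (contrapT (dF i))).
  - by exists 0.
  - exact: openT.
  have [M vM] := vb y; have [j _ /= Mj] := Fy (Num.truncn M).+1 Logic.I.
  by have := lt_trans (truncnS_gt M) Mj; rewrite ltNge vM.
move: ndF => /existsNP[W /not_implyP[[a0 Wa0] /not_implyP[oW WF]]].
have [/= r r0 rW] : nbhs a0 W by exact: open_nbhs_nbhs.
have [M vM] := vb (a - a0).
exists (i%:R + M), r; split=> // j y yr.
rewrite -[y](subrK (a - a0)) (le_trans (vD _ _ _))// lerD//.
rewrite leNgt; apply/negP => iv; apply: WF; exists (y - (a - a0)); split; last by exists j.
by apply: rW; rewrite /= ltr_distlC; apply/andP; split; lra.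
Qed.

(** * Tails of integrals *)

Section integral_tail.
Context {R : realType}.
Local Notation leb := (@lebesgue_measure R).
Local Notation Rm := (measurableTypeR R).

Lemma ge0_integral_tail_cvg0 (f : Rm -> \bar R) (C : R) :
  measurable_fun setT f -> (forall t, 0 <= f t)%E -> (forall t, f t \is a fin_num) ->
  (forall N : nat, \int[leb]_(t in `]0%R, N%:R]) f t <= C%:E)%E ->
  (\int[leb]_(t in `[n.+1%:R, +oo[) f t)%E @[n --> \oo] --> 0%E.
Proof.
move=> mf f0 ffin fC.
pose F := f \_ (`]0, +oo[%classic : set Rm).
have mr (B : set Rm) : measurable B -> measurable_fun setT (f \_ B).
  by move=> mB; apply/(measurable_restrictT _ _).1 => //; exact: measurable_funTS.
have r0 (B : set Rm) t : (0 <= (f \_ B) t)%E by exact: erestrict_ge0.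
have FC : (\int[leb]_t F t <= C%:E)%E.
  pose G n := f \_ (`]0, n%:R]%classic : set Rm).
  have GF t : G n t @[n --> \oo] --> F t.
    apply: cvg_near_cst; near=> n; rewrite /G /F !patchE; congr (if _ then _ else _).
    apply/idP/idP; rewrite !inE/= !in_itv/= ?andbT; first by case/andP.
    move=> ->/=; near: n; exact: nbhs_infty_ger.
  have := @cvg_monotone_convergence _ _ _ leb setT measurableT G.
  move=> /(_ (fun n => mr _ _) (fun n t _ => r0 _ _)) H.
  have ndG t : [set: Rm] t -> nondecreasing_seq (G ^~ t).
    move=> _ m n mn; rewrite /G !patchE.
    case: ifPn => [|_]; last by case: ifP.
    rewrite inE/= in_itv/= => /andP[t0 tm]; rewrite ifT// inE/= in_itv/= t0/=.
    by rewrite (le_trans tm)// ler_nat.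
  have {H}H := H (fun n => (ltac:(done) : measurable (`]0, n%:R]%classic : set Rm))) ndG.
  have <- : (\int[leb]_t (limn (G ^~ t)) = \int[leb]_t F t)%E.
    by apply: eq_integral => t _; exact/cvg_lim.
  rewrite -(cvg_lim _ H)//; apply: lime_le; first by apply/cvg_ex; eexists; exact: H.
  by near=> n; rewrite -integral_mkcond.
have := @dominated_cvg _ _ _ leb setT measurableT
  (fun n => f \_ (`[n.+1%:R, +oo[%classic : set Rm)) (cst 0%E) F.
rewrite integral0 => tail.
rewrite (_ : (fun n => _) = fun n : nat => \int[leb]_t (f \_ (`[n.+1%:R, +oo[%classic : set Rm)) t)%E; last first.
  by apply/funext => n; rewrite -integral_mkcond.
apply: tail.
- by move=> n; exact: mr.
- move=> t _; apply: cvg_near_cst; near=> n; rewrite patchE memNset//=.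
  rewrite in_itv/= andbT => nt.
  have tn : t < n%:R by near: n; exact: nbhs_infty_gtr.
  by have := le_lt_trans nt tn; rewrite ltr_nat ltnNge leqnSn.
- by move=> t _; rewrite /F patchE; case: ifP => _; first exact: ffin.
- apply/integrableP; split; first exact: mr.
  rewrite (eq_integral F) => [|t _]; last by rewrite gee0_abs// r0.
  by rewrite (le_lt_trans FC)// ltry.
- move=> n t _; rewrite gee0_abs// /F !patchE; case: ifPn => [|_]; last by case: ifP.
  rewrite inE/= in_itv/= andbT => nt; rewrite ifT// inE/= in_itv/= andbT.
  by rewrite (lt_le_trans _ nt).
Unshelve. all: by end_near. Qed.

End integral_tail.

(** * Short-time confinement *)

Section confinement.
Context {R : realType} (P : probability (cadlag_path R) R).
Hypothesis P_levy : levy_process P.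
Local Notation D := (cadlag_path R).
Implicit Types (x y z s t r tau : R) (w : D).

(** Grid times make this event measurable; by right-continuity, the path is then
    within r of z at all times before tau ([confined_le]). *)
Definition confined z r tau : set D :=
  \bigcap_k unvisited [set y | r < `|y - z|] 0 k.+1%:R^-1 tau.

Lemma open_far z r : open [set y | r < `|y - z|].
Proof.
apply: (open_comp (f := fun y => `|y - z|) (D := [set a | r < a])); last exact: open_gt.
move=> y _; apply: (continuous_comp (f := fun y => y - z)).
  by apply: cvgB; [exact: cvg_id|exact: cvg_cst].
exact: norm_continuous.
Qed.

Lemma confined_le z r tau w : confined z r tau w ->
  forall s, 0 <= s -> s < tau -> `|state w s - z| <= r.
Proof.
move=> cw s s0 st; rewrite leNgt; apply/negP => far.
have [k _ /(_ k (leqnn k)) [j /andP[_ jt] Oj]] := grid_visit (@open_far z r) s0 far st.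
exact: cw k Logic.I j (ltW jt) Oj.
Qed.

Lemma measurable_confined z r tau : measurable (confined z r tau).
Proof.
apply: bigcap_measurable => // k _.
apply: (@natural_filtration_measurable _ tau).
have d0 : 0 <= k.+1%:R^-1 :> R by rewrite invr_ge0.
exact: natural_filtration_unvisited (lexx 0) d0 (open_measurable (@open_far z r)).
Qed.

Lemma law_from_confined z r tau : law_from P z (confined z r tau) = P (confined 0 r tau).
Proof.
have [N [mN N0 Nalive]] := never_dead_ae P_levy.
apply: (measure_eq_ae mN N0) => [||w /Nalive[_ wt]].
- rewrite -[X in measurable X]setTI.
  exact: (measurable_translate z measurableT (measurable_confined z r tau)).
- exact: measurable_confined.
- rewrite /confined /unvisited /=.
  by split=> cw k kT j jt /=; move: (cw k kT j jt) => /=;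
    rewrite state_translate// subr0 addrAC subrr add0r.
Qed.

(** The path starts at 0 almost surely and is right-continuous, so that these
    events increase to an almost sure one as tau decreases to 0. *)
Lemma confined_likely r : 0 < r ->
  exists2 tau, 0 < tau & ((2^-1)%:E <= P (confined 0 r tau))%E.
Proof.
move=> r0; pose G k := confined 0 r k.+1%:R^-1.
have mG k : measurable (G k) by exact: measurable_confined.
have ndG : {homo G : k l / (k <= l)%N >-> (k <= l)%O}.
  move=> k l kl; apply/subsetPset => w Gw i iT j jl; apply: Gw => //.
  by rewrite (le_trans jl)// lef_pV2 ?posrE// ler_nat.
have mUG : measurable (\bigcup_k G k) by exact: bigcupT_measurable.
have UG : P (\bigcup_k G k) = 1%E.
  have [N [mN N0 Nalive]] := never_dead_ae P_levy.
  rewrite -(probability_setT P); apply: (measure_eq_ae mN N0) => // w /Nalive[w0 _].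
  split=> // _; have s0 : state w 0 = 0 by rewrite /state w0.
  have oI : open (`]- r, r[%classic : set R) by exact: interval_open.
  have I0 : (`]- r, r[%classic : set R) (state w 0).
    by rewrite s0 /= in_itv/= oppr_lt0 r0.
  have [e e0 eI] := state_right_near oI I0.
  have [k _ /(_ k (leqnn k)) ke] := near_infty_natSinv_lt (PosNum e0).
  exists k => // i _ j jk /=; rewrite subr0 => far.
  have j0 : 0 <= grid 0 (i.+1%:R^-1 : R) j by apply: grid_ge0 => //; rewrite invr_ge0.
  move: j0; rewrite le_eqVlt => /predU1P[j0|j0].
    by move: far; rewrite -j0 s0 normr0 ltNge (ltW r0).
  have := eI _ j0; rewrite add0r => /(_ (le_lt_trans jk ke)).
  by rewrite /= in_itv/= -ltr_norml ltNge (ltW far).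
have cvgG : P (G k) @[k --> \oo] --> 1%E by rewrite -UG; exact: nondecreasing_cvg_mu.
have half1 : ((2^-1)%:E < 1%:E :> \bar R)%E by rewrite lte_fin; lra.
have nb := open_nbhs_nbhs (conj (@open_ereal_gt_ereal _ (2^-1)%:E) half1).
have [k _ /(_ k (leqnn k)) /= H] := cvgG _ nb.
by exists k.+1%:R^-1; [rewrite invr_gt0|exact: ltW].
Qed.

End confinement.

(** * Visits at arbitrarily late times *)

Section recurrence.
Context {R : realType}.
Local Notation D := (cadlag_path R).
Implicit Types (O : set R) (s : R) (w : D).

(** The paths found in O after time s by all fine enough grids: a measurable event
    that contains the paths visiting O after s when O is open
    ([reach_visit]). *)
Definition reach O s : set D :=
  \bigcup_m \bigcap_(k >= m) \bigcup_j visit O s k.+1%:R^-1 j.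

Definition recur O : set D := \bigcap_m reach O m.+1%:R.

Lemma measurable_visits O s d : measurable O -> measurable (\bigcup_j visit O s d j).
Proof. by move=> mO; apply: bigcupT_measurable => j; exact: measurable_state_event. Qed.

Lemma measurable_reach O s : measurable O -> measurable (reach O s).
Proof.
move=> mO; apply: bigcupT_measurable => m; apply: bigcap_measurable => [|k _].
  by exists m => /=.
exact: measurable_visits.
Qed.

Lemma measurable_recur O : measurable O -> measurable (recur O).
Proof. by move=> mO; apply: bigcap_measurable => // m _; exact: measurable_reach. Qed.

Lemma reach_visit O s t w : open O -> s <= t -> O (state w t) -> reach O s w.
Proof.
move=> oO st Ot; have t1 : t < t + 1 by rewrite ltrDl.
have [m _ H] := grid_visit oO st Ot t1.
by exists m => // k mk; have [j _ Oj] := H k mk; exists j.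
Qed.

Lemma reach_le (mu : {measure set D -> \bar R}) O s (c : \bar R) : measurable O ->
  (forall k, mu (\bigcup_j visit O s k.+1%:R^-1 j) <= c)%E -> (mu (reach O s) <= c)%E.
Proof.
move=> mO H; pose F m := \bigcap_(k >= m) \bigcup_j visit O s k.+1%:R^-1 j.
have mF m : measurable (F m).
  apply: bigcap_measurable => [|k _]; first by exists m => /=.
  exact: measurable_visits.
have ndF : {homo F : k l / (k <= l)%N >-> (k <= l)%O}.
  by move=> k l kl; apply/subsetPset => w Fw i /= li; apply: Fw; exact: leq_trans li.
have cvgF := nondecreasing_cvg_mu (mu := mu) mF (bigcupT_measurable _ mF) ndF.
rewrite /reach -(cvg_lim _ cvgF)//; apply: lime_le; first by apply/cvg_ex; eexists; exact: cvgF.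
near=> m; apply: le_trans (H m) => /=; apply: le_measure; rewrite ?inE//.
  exact: measurable_visits.
by move=> w; apply => /=.
Unshelve. all: by end_near. Qed.

End recurrence.

Section late_visits.
Context {R : realType}.
Local Notation D := (cadlag_path R).
Implicit Types (K : set R) (w : D).

Definition late_visits K w := forall m : nat, exists2 t, m%:R <= t & coord_event t K w.

Lemma last_exit_time_late_visits K w : ~ (last_exit_time K w < +oo)%E -> late_visits K w.
Proof.
move=> notfin m; apply: contrapT => Hm; apply: notfin.
apply: (@le_lt_trans _ _ m%:R%:E); last exact: ltry.
apply: ge_ereal_sup => _ [->|[t [t0 Kt] <-]]; rewrite lee_fin//.
by rewrite leNgt; apply/negP => mt; apply: Hm; exists t => //; exact: ltW.
Qed.

Lemma late_visits_shift K w : late_visits K w -> late_visits K (path_shift 1 w).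
Proof.
move=> lw m; have [t mt Kt] := lw m.+1; exists (t - 1).
  by rewrite lerBrDr natr1.
have t1 : 0 <= t - 1 by rewrite subr_ge0 (le_trans _ mt)// ler1n.
by case: Kt => y wt Ky; exists y => //=; rewrite (max_r ler01) (max_r t1) subrKC.
Qed.

Lemma measurable_path_shift (s : R) : measurable_fun setT (@path_shift R s).
Proof.
apply: (@measurability _ _ _ _ setT _ (@cylinders R)) => //.
move=> _ [_ [r [A [r0 mA ->]]] <-]; rewrite setTI.
rewrite (_ : _ @^-1` _ = coord_event (Num.max 0 s + Num.max 0 r) A).
  by apply: measurable_coord_event => //; rewrite addr_ge0// le_max lexx.
by apply/seteqP; split.
Qed.

Lemma late_visits_cover (I : eqType) (s : seq I) (O : I -> set R) w :
  late_visits [set y | exists2 i, i \in s & O i y] w ->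
  exists2 i, i \in s & late_visits (O i) w.
Proof.
elim: s => [|a s IHs] lw; first by have [t _ [y _ []]] := lw 0%N.
have [la|/existsNP[m0 nla]] := pselect (late_visits (O a) w).
  by exists a => //; rewrite inE eqxx.
have [|i si li] := IHs; last by exists i => //; rewrite inE si orbT.
move=> m; have [t mt [y wt [i + Oy]]] := lw (maxn m m0).
rewrite inE => /predU1P[ia|si].
  exfalso; apply: nla; exists t; last by exists y; rewrite // -ia.
  by rewrite (le_trans _ mt)// ler_nat leq_maxr.
exists t; first by rewrite (le_trans _ mt)// ler_nat leq_maxl.
by exists y => //; exists i.
Qed.

Lemma late_visits_recur (O : set R) w : open O -> late_visits O w -> recur O w.
Proof.
move=> oO lw m _; have [t mt [y wt Oy]] := lw m.+1.
by apply: (reach_visit oO mt); rewrite /state wt.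
Qed.

End late_visits.

(** * The conditioned process *)

Section conditioned.
Context {R : realType} (P : probability (cadlag_path R) R).
Context (n : {sigma_finite_measure set (cadlag_path R) -> \bar R}).
Context (h : R -> R) (Pud : R -> probability (cadlag_path R) R).
Hypothesis P_levy : levy_process P.
Hypothesis h_ge0 : forall x, 0 <= h x.
Hypothesis h_continuous : continuous h.
Hypothesis h0 : h 0 = 0.
Hypothesis Pud_laws : avoiding_zero_laws P n h Pud.
Local Notation D := (cadlag_path R).
Local Notation Rm := (measurableTypeR R).
Local Notation leb := (@lebesgue_measure R).
Local Notation itv a e := (`]a - e, a + e[%classic : set R).
Implicit Types (x y z s t d r M : R) (O A : set R) (L : set D).

Let Pud_hE x t L : 0 < h x -> 0 < t -> natural_filtration t L -> Pud x L =
  ((h x)^-1%:E * \int[law_from P x]_(w in L `&` [set w | (t%:E < hitting_time0 w)%E])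
    (h (state w t))%:E)%E.
Proof.
by move=> hx t0 /natural_filtration_right; have [+ _] := Pud_laws; exact.
Qed.

(** Forgetting that 0 has not been hit only increases the integral. *)
Lemma Pud_le x t L M : 0 < h x -> 0 < t -> natural_filtration t L ->
  (forall w, L w -> h (state w t) <= M) ->
  (Pud x L <= (M / h x)%:E * law_from P x L)%E.
Proof.
move=> hx t0 tL LM; have mL := natural_filtration_measurable tL.
rewrite (Pud_hE hx t0 tL) mulrC EFinM -muleA lee_pmul2l//; last by rewrite lte_fin invr_gt0.
have [->|L0] := eqVneq L set0.
  by rewrite set0I integral_set0 measure0 mule0.
have M0 : 0 <= M by have /set0P[w Lw] := L0; exact: le_trans (LM w Lw).
rewrite -(integral_cst (law_from P x) mL M%:E).
apply: ge0_le_integral_subset => [w _|w _|w]; rewrite ?lee_fin//.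
by move=> [Lw _]; split => //; exact: LM.
Qed.

(** The same bound for an event decided at time 0, once it is negligible before
    conditioning. *)
Lemma Pud_initial0 x L : 0 < h x -> natural_filtration 0 L ->
  law_from P x L = 0%E -> Pud x L = 0%E.
Proof.
move=> hx L0' PL; have mL := natural_filtration_measurable L0'.
rewrite (Pud_hE hx ltr01 (natural_filtration_le ler01 L0')).
apply/eqP; rewrite eq_le; apply/andP; split; last first.
  by rewrite mule_ge0 ?lee_fin ?invr_ge0// integral_ge0// => w _; rewrite lee_fin.
rewrite -[leRHS](mule0 (h x)^-1%:E) lee_pmul2l ?lte_fin ?invr_gt0//.
have mh : measurable_fun setT (fun w : D => (h (state w 1))%:E).
  apply/measurable_EFinP; apply: (measurableT_comp (f := h)).
    exact: continuous_measurable_fun.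
  exact: measurable_state.
apply: (@le_trans _ _ (\int[law_from P x]_(w in L) (h (state w 1))%:E)%E).
  by apply: ge0_le_integral_subset => [w _|w _|w []]; rewrite ?lee_fin.
rewrite (ge0_negligible_integral mL mL _ _ PL) ?setDv ?integral_set0//.
- exact: measurable_funTS.
- by move=> w _; rewrite lee_fin.
Qed.

Lemma law_from_initial x (B : set R) : measurable B -> ~ B x ->
  law_from P x [set w | B (state w 0)] = 0%E.
Proof.
move=> mB Bx; rewrite law_from_state//.
have [N [mN N0 Nalive]] := never_dead_ae P_levy.
rewrite -(measure0 P); apply: (measure_eq_ae mN N0) => //.
  rewrite -[X in measurable X]setTI.
  by apply: (measurable_funD (f := cst x) (measurable_cst _) (measurable_state 0)).
by move=> w /Nalive[w0 _] /=; split => //; rewrite /state w0/= addr0.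
Qed.

(** The conditioned process rarely approaches 0: at its first visit to O the
    density of its law, h divided by h x, is at most M / h x. *)
Lemma Pud_visit_le x O M s d : 0 < h x -> measurable O -> 0 <= M ->
  (forall y, O y -> h y <= M) -> 0 <= s -> 0 < d -> 0 < s \/ ~ O x ->
  (Pud x (\bigcup_j visit O s d j) <= (M / h x)%:E)%E.
Proof.
move=> hx mO M0 OM s0 d0 sO.
have mF j := measurable_first_visit j s0 (ltW d0) mO.
have mU : measurable (\bigcup_j first_visit O s d j) by exact: bigcupT_measurable.
have tF : trivIset setT (first_visit O s d) by exact: trivIset_seqDU.
rewrite (seqDU_bigcup_eq (visit O s d)).
rewrite (measure_semi_bigcup (Pud x) mF tF mU).
have c0 : 0 <= M / h x by rewrite divr_ge0// ltW.
apply: (@le_trans _ _ ((M / h x)%:E * law_from P x (\bigcup_j first_visit O s d j)))%E; last first.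
  by rewrite -[leRHS]mule1 lee_wpmul2l ?lee_fin// probability_le1.
rewrite (measure_semi_bigcup (law_from P x) mF tF mU) -nneseriesZl//.
apply: lee_nneseries => // j _.
have gF := natural_filtration_first_visit (j := j) s0 (ltW d0) mO.
have [g0|g0] := ltP 0 (grid s d j).
  by apply: (Pud_le hx g0 gF) => w /first_visit_visit; exact: OM.
have gE : grid s d j = 0 by apply/eqP; rewrite eq_le g0 grid_ge0// ltW.
have sz : s = 0.
  apply/eqP; rewrite eq_le s0 andbT -gE /grid lerDl mulr_ge0// ltW//.
have Ox : ~ O x by case: sO => //; rewrite sz ltxx.
have P0 : law_from P x (first_visit O s d j) = 0%E.
  apply: (subset_measure0 _ _ _ (law_from_initial mO Ox)) => //.
  - exact: measurable_state_event.
  - by move=> w /first_visit_visit; rewrite gE.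
have gF0 : natural_filtration 0 (first_visit O s d j) by rewrite -[X in natural_filtration X]gE.
by rewrite [X in (_ <= _ * X)%E]P0 mule0 [X in (X <= _)%E](Pud_initial0 hx gF0 P0).
Qed.

Variable (u : R -> R -> R).
Hypothesis uP : forall q : R, 0 < q -> resolvent_density P q (u q).
Hypothesis h_lim : forall x, u q 0 - u q (- x) @[q --> 0^'+] --> h x.

(* Rates that tend to 0, along which the differences v j tend to h. *)
Let rate (j : nat) : {posnum R} := (j.+1%:R^-1)%:pos.

Let v (j : nat) (a : R) := u (rate j)%:num 0 - u (rate j)%:num (- a).

Let v_bounded a : exists M, forall j, v j a <= M.
Proof.
have rate0 : (rate j)%:num @[j --> \oo] --> (0 : R)^'+.
  move=> A [/= e e0 eA]; suff : \forall j \near \oo, A (rate j)%:num by [].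
  near=> j; apply: eA => //=; rewrite sub0r normrN gtr0_norm//.
  by near: j; exact: near_infty_natSinv_lt (PosNum e0).
have va : v j a @[j --> \oo] --> h a by exact: cvg_comp rate0 (@h_lim a).
have : has_ubound (range (v ^~ a)).
  by apply/bounded_fun_has_ubound/cvg_seq_bounded/cvg_ex; exists (h a).
by move=> [M vM]; exists M => j; apply: vM; exists j.
Unshelve. all: by end_near. Qed.

Let v_locally_bounded a : exists M r, 0 < r /\ forall j y, a - r < y < a + r -> v j y <= M.
Proof.
apply: subadditive_locally_bounded => [j|j b c|b].
- have [cu _] := uP (gt0 (rate j)).
  move=> y; apply: cvgB; first exact: cvg_cst.
  by apply: (continuous_comp (f := -%R)); [exact: opp_continuous|exact: cu].
- exact: (resolvent_subadditive P_levy (uP (gt0 (rate j)))).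
- exact: v_bounded.
Qed.

(** With p the Laplace transform of the first visit to a neighbourhood of 0, the
    mean density of the killed law on the interval is at most q times u_q(0) - p (u_q(0) - M), where M
    bounds the differences v j near - z0; and u_q(0) (1 - p) is bounded because p
    is at least about u_q(- x) / u_q(0). *)
Let killed_clock_law_bounded z0 : exists M r1, [/\ 0 <= M, 0 < r1 &
  forall r x, 0 < r -> r <= r1 -> exists K, forall j, exists2 e0, 0 < e0 &
    forall e, 0 < e -> e < e0 -> exists k,
      (killed_clock_law P (rate j) x (itv 0 e) 0 k.+1%:R^-1 (itv z0 r) <=
        ((rate j)%:num * (2 * r * (K + M)))%:E)%E].
Proof.
have [M [rho [rho0 vM]]] := v_locally_bounded (- z0).
exists (Num.max 0 M), (rho / 2); split; [by rewrite le_max lexx|lra|].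
move=> r x r0 rr1; have [K vK] := v_bounded x.
(* 2 absorbs the error terms of [visit_laplace_ge], applied with e = 1. *)
exists (K + 2) => j.
have uq : resolvent_density P (rate j)%:num (u (rate j)%:num) by exact: uP.
have [e0 e00 He] := visit_laplace_ge P_levy uq x ltr01.
exists (Num.min e0 (rho / 2)); first by rewrite lt_min e00; lra.
move=> e ep; rewrite lt_min => /andP[ee0 er].
have [k [p [pE p0 p1 hp]]] := He e ep ee0; exists k.
have u0 := resolvent_density_ge0 uq 0.
have mI a b : measurable (itv a b : set R) by [].
have d0 : 0 <= k.+1%:R^-1 :> R by rewrite invr_ge0.
pose q := (rate j)%:num; have q0 : 0 < q by rewrite /q.
pose m := q * (2 * r * Num.max 0 (u q 0 - M)).
have m0 : 0 <= m.
  apply: mulr_ge0; first exact: ltW.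
  by apply: mulr_ge0; [lra|rewrite le_max lexx].
have lo y : itv 0 e y -> (m%:E <= clock_law P (rate j) y (itv z0 r))%E.
  rewrite /= in_itv/= => ye; apply: (clock_law_itv_ge uq) => //.
    by rewrite le_max lexx.
  move=> y' y'r; rewrite ge_max (resolvent_density_ge0 uq)/=.
  have := vM j (y - y'); rewrite /v opprB -/q => H.
  have : u q 0 - u q (y' - y) <= M by apply: H; apply/andP; split; lra.
  lra.
have H := clock_law_ge P_levy x (lexx 0) d0 (mI 0 e) (mI z0 r) m0 lo.
have up : (clock_law P (rate j) x (itv z0 r) <= (q * (2 * r * u q 0))%:E)%E.
  by apply: (clock_law_itv_le uq) => // y _; exact: (resolvent_density_le0 P_levy uq).
have {H up}H := le_trans H up.
rewrite pE -EFinM in H.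
have -> : (q * (2 * r * (K + 2 + Num.max 0 M)))%:E =
   ((q * (2 * r * (K + 2 + Num.max 0 M)) + m * p)%:E - (m * p)%:E)%E.
  by rewrite -EFinB addrK.
rewrite leeBrDr// (le_trans H)// lee_fin /m.
have := vK j; rewrite /v -/q => vKj.
have a1 : u q 0 - M <= Num.max 0 (u q 0 - M) by rewrite le_max lexx orbT.
have a2 : M <= Num.max 0 M by rewrite le_max lexx orbT.
have a3 : 0 <= Num.max 0 M by rewrite le_max lexx.
have a4 := ler_wpM2r p0 a1.
have a5 := ler_wpM2r p0 a2.
have a6 : Num.max 0 M * p <= Num.max 0 M by rewrite ler_piMr.
have key : 0 <= K + 2 + Num.max 0 M + Num.max 0 (u q 0 - M) * p - u q 0.
  by move: a4 a5 a6 hp vKj p1; rewrite -/q; lra.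
rewrite -subr_ge0 (_ : _ - _ =
  q * (2 * r * (K + 2 + Num.max 0 M + Num.max 0 (u q 0 - M) * p - u q 0))); last by ring.
by apply: mulr_ge0; [exact: ltW|apply: mulr_ge0 => //; lra].
Qed.

(** Up to time N, a rate q of order 1 / N makes the discounting harmless, and a
    neighbourhood O of 0 that is small enough, depending on N, is visited with
    probability at most 1 / (N + 1). This leaves the killed potential, which is
    bounded uniformly in q. *)
Lemma potential_bounded z0 : exists2 r1, 0 < r1 &
  forall r x, 0 < r -> r <= r1 -> 0 < h x -> exists C, forall N : nat,
    (\int[leb]_(t in `]0%R, N%:R]) Pud x [set w | itv z0 r (state w t)] <= C%:E)%E.
Proof.
have [M [r1 [M0 r10 HM]]] := killed_clock_law_bounded z0.
have [r2 r20 hz] := continuous_near z0 h_continuous ltr01.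
exists (Num.min r1 r2); first by rewrite lt_min r10.
move=> r x r0; rewrite le_min => /andP[rr1 rr2] hx.
have [K HK] := HM r x r0 rr1.
have z01 : 0 < h z0 + 1 by have := h_ge0 z0; lra.
pose c := (h z0 + 1) / h x.
have c0 : 0 <= c by rewrite divr_ge0// ltW.
exists (1 + c * (expR 1 * (2 * r * (K + M)))) => N.
have [e0 e00 He] := HK N.
(* If h is at most m on O, then O is visited with probability at most m / h x,
   that is, 1 / (N + 1). *)
pose m := h x / N.+1%:R.
have m0 : 0 < m by rewrite divr_gt0.
have [rho rho0 hrho] := continuous_near 0 h_continuous m0.
have x0 : 0 < `|x| by rewrite normr_gt0; apply: contraTneq hx => ->; rewrite h0 ltxx.
have [e [ep ee0 erho ex]] : exists e, [/\ 0 < e, e < e0, e <= rho & e <= `|x|].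
  exists (Num.min (e0 / 2) (Num.min rho `|x|)); split.
  - by rewrite !lt_min rho0 x0 !andbT divr_gt0.
  - by rewrite gt_min; apply/orP; left; lra.
  - by rewrite !ge_min lexx !orbT.
  - by rewrite !ge_min lexx !orbT.
have [k Hk] := He e ep ee0.
set O := (`]0 - e, 0 + e[%classic : set R) in Hk.
set B := (`]z0 - r, z0 + r[%classic : set R) in Hk *.
have mO : measurable O by exact: measurable_itv.
have mB : measurable B by exact: measurable_itv.
pose d : R := k.+1%:R^-1.
have d0 : 0 < d by rewrite invr_gt0.
have Ox : ~ O x.
  rewrite /O /= in_itv/= sub0r add0r -ltr_norml => /(le_lt_trans ex).
  by rewrite ltxx.
pose S := [set p : Rm * D | unvisited O 0 d p.1 p.2 /\ B (state p.2 p.1)].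
have mS : measurable S.
  by apply: measurableI; [exact: measurable_unvisited_joint|exact: measurable_clock_event].
pose g (t : Rm) := law_from P x [set w | unvisited O 0 d t w /\ B (state w t)].
have mg : measurable_fun setT g.
  apply: eq_measurable_fun (measurable_fun_xsection (law_from P x) mS) => t _ /=.
  by congr (law_from P x _); apply/seteqP; split=> w; rewrite /xsection/= inE.
have g0 t : (0 <= g t)%E by exact: measure_ge0.
have gK : (\int[exp_clock (rate N)]_t g t = killed_clock_law P (rate N) x O 0 d B)%E.
  rewrite /killed_clock_law /product_measure1; apply: eq_integral => t _ /=.
  by congr (law_from P x _); apply/seteqP; split=> w; rewrite /xsection/= inE.
have bound (t : Rm) : 0 < t ->
    (Pud x [set w | B (state w t)] <= (m / h x)%:E + c%:E * g t)%E.
  move=> t0.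
  have nS : natural_filtration t [set w | unvisited O 0 d t w /\ B (state w t)].
    apply: natural_filtrationI; first exact: natural_filtration_unvisited (lexx 0) (ltW d0) mO.
    by apply: natural_filtration_state => //; rewrite lexx ltW.
  have mV : measurable (\bigcup_j visit O 0 d j).
    by apply: bigcupT_measurable => j; exact: measurable_state_event.
  apply: (@le_trans _ _ (Pud x (\bigcup_j visit O 0 d j `|`
      [set w | unvisited O 0 d t w /\ B (state w t)]))).
    apply: le_measure; rewrite ?inE.
    - exact: measurable_state_event.
    - by apply: measurableU => //; exact: natural_filtration_measurable nS.
    - move=> w Bw; have [?|] := pselect (unvisited O 0 d t w); first by right.
      move=> /(unvisited_setC O 0 t w (ltW d0))[j _ /first_visit_visit Oj].
      by left; exists j.
  apply: (le_trans (measureU2 _ mV (natural_filtration_measurable nS))).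
  apply: leeD.
    apply: Pud_visit_le => //; [exact: ltW| |by right].
    move=> y; rewrite /O /= in_itv/= => yO.
    have /hrho/andP[_ /ltW] : 0 - rho < y < 0 + rho by apply/andP; split; lra.
    by rewrite h0 add0r.
  apply: (Pud_le hx t0 nS) => w [_]; rewrite /B /= in_itv/= => wB.
  by have /hz/andP[_ /ltW] : z0 - r2 < state w t < z0 + r2 by apply/andP; split; lra.
have mI : measurable (`]0%R, N%:R]%classic : set Rm) by [].
apply: (@le_trans _ _ (\int[leb]_(t in `]0%R, N%:R]) ((m / h x)%:E + c%:E * g t))%E).
  apply: ge0_le_integral_subset => t //=.
    by move=> _; rewrite adde_ge0 ?mule_ge0// lee_fin// divr_ge0// ltW.
  by rewrite in_itv/= => /[dup] tN /andP[t0 _]; split => //; exact: bound.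
have mcg : measurable_fun setT (fun t : Rm => c%:E * g t)%E by exact: measurable_funeM.
rewrite ge0_integralD//; last 3 first.
- by move=> t _; rewrite lee_fin divr_ge0// ltW.
- by move=> t _; rewrite mule_ge0.
- exact: measurable_funTS.
rewrite EFinD; apply: leeD.
  rewrite (integral_cst leb mI) [X in (_ * X)%E]lebesgue_measure_itv/= lte_fin.
  case: ifPn => [N0|_]; last by rewrite mule0 lee_fin.
  rewrite -EFinB -EFinM lee_fin /m subr0 [h x / _]mulrC mulfK ?gt_eqF//.
  by rewrite mulrC ler_pdivrMr// mul1r ler_nat.
rewrite ge0_integralZl//; last exact: measurable_funTS.
rewrite [leRHS]EFinM; apply: lee_wpmul2l; first by rewrite lee_fin.
apply: (@le_trans _ _ (\int[leb]_(t in `[0%R, N%:R]) g t)%E).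
  apply: ge0_le_integral_subset => t //=; rewrite !in_itv/= => /andP[t0 tN].
  by rewrite (ltW t0) tN.
apply: (le_trans (ge0_integral_le_exp_clock (rate N) N%:R mg g0)).
rewrite gK; set q := (rate N)%:num.
have q0 : 0 < q by rewrite /q.
have qN : q * N%:R <= 1 by rewrite /q /= mulrC ler_pdivrMr// mul1r ler_nat.
apply: (@le_trans _ _ ((expR 1 / q)%:E * killed_clock_law P (rate N) x O 0 d B)%E).
  by rewrite lee_wpmul2r ?measure_ge0// lee_fin ler_pM2r ?invr_gt0// ler_expR.
apply: (le_trans (lee_wpmul2l _ Hk)); first by rewrite lee_fin divr_ge0 ?expR_ge0// ltW.
by rewrite -EFinM lee_fin -/q (mulrA (expR 1 / q)) divfK ?gt_eqF.
Qed.

(** Near a point of positivity of h, conditioning costs a bounded factor over a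
    short time, during which the process typically has not moved. *)
Lemma Pud_stays z0 r1 : 0 < h z0 -> 0 < r1 -> exists r tau,
  [/\ 0 < r, 2 * r <= r1, 0 < tau, 2 * r <= `|z0| &
   forall z, itv z0 r z -> 0 < h z /\ forall t, 0 < t -> t < tau ->
     ((6^-1)%:E <= Pud z [set w | itv z0 (2 * r) (state w t)])%E].
Proof.
move=> hz0 r10; have e0 : 0 < h z0 / 2 by lra.
have [r2 r20 hr2] := continuous_near z0 h_continuous e0.
have z00 : 0 < `|z0| by rewrite normr_gt0; apply: contraTneq hz0 => ->; rewrite h0 ltxx.
have [r [r0 rr1 rr2 rz0]] : exists r, [/\ 0 < r, 2 * r <= r1, 2 * r <= r2 & 2 * r <= `|z0|].
  exists (Num.min r1 (Num.min r2 `|z0|) / 2); rewrite mulrCA divff// mulr1; split.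
  - by rewrite divr_gt0// !lt_min r10 r20.
  - by rewrite !ge_min lexx.
  - by rewrite !ge_min lexx !orbT.
  - by rewrite !ge_min lexx !orbT.
have [tau tau0 Ptau] := confined_likely P_levy r0.
exists r, tau; split => // z; rewrite /= in_itv/= => zr.
have /hr2/andP[hz1 hz2] : z0 - r2 < z < z0 + r2 by apply/andP; split; lra.
have hz : 0 < h z by lra.
split=> // t t0 ttau; set L := [set w | _].
have mB : measurable (itv z0 (2 * r)) by exact: measurable_itv.
have tt : 0 <= t <= t by rewrite lexx ltW.
have nL : natural_filtration t L := natural_filtration_state tt mB.
have [+ _] := Pud_laws; move=> /(_ z t L hz t0 (natural_filtration_right nL)) ->.
have mG := measurable_confined z r tau.
apply: (@le_trans _ _ (((h z)^-1)%:E *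
    \int[law_from P z]_(w in confined z r tau) (h z0 / 2)%:E)%E).
  rewrite (integral_cst (law_from P z) mG) [X in (_ * (_ * X))%E](law_from_confined P_levy).
  rewrite muleA -EFinM.
  have c0 : (0 <= ((h z)^-1 * (h z0 / 2))%:E)%E.
    by rewrite lee_fin mulr_ge0 ?invr_ge0// ltW.
  apply: le_trans (lee_wpmul2l c0 Ptau); rewrite -EFinM lee_fin.
  (* 1/6 is 1/2 (confinement) times 1/3: on the interval, h is between h z0 / 2
     and 3 h z0 / 2. *)
  by rewrite -mulrA mulrC ler_pdivlMr//; lra.
rewrite lee_wpmul2l ?lee_fin ?invr_ge0 ?(ltW hz)//.
apply: ge0_le_integral_subset => [w _|w _|w cw]; [by rewrite lee_fin ltW|by rewrite lee_fin|].
have near s : 0 <= s -> s < tau -> z0 - 2 * r < state w s < z0 + 2 * r.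
  by move=> s0 st; have := confined_le cw s0 st; rewrite ler_distl => /andP[? ?];
    apply/andP; split; lra.
split; last first.
  rewrite lee_fin.
  have /hr2/andP[+ _] : z0 - r2 < state w t < z0 + r2.
    by have /andP[? ?] := near t (ltW t0) ttau; apply/andP; split; lra.
  by move=> ?; lra.
split; first by rewrite /L /= in_itv/= near// ltW.
rewrite /=; apply: (@lt_le_trans _ _ tau%:E); first by rewrite lte_fin.
apply: le_ereal_inf_tmp => _ [s [s0 ws] <-]; rewrite lee_fin leNgt; apply/negP => st.
have := near s (ltW s0) st; rewrite /state ws/= => /andP[? ?].
by move: rz0; apply/negP; rewrite -ltNge ltr_norml; apply/andP; split; lra.
Qed.

Hypothesis Pud_markov : markov_family (posset0 h) Pud.

Let measurable_occupation x (B : set R) : measurable B ->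
  measurable_fun setT (fun t : Rm => Pud x [set w | B (state w t)]).
Proof.
move=> mB; apply: eq_measurable_fun (measurable_fun_xsection (Pud x) (measurable_clock_event mB)) => t _ /=.
by congr (Pud x _); apply/seteqP; split=> w; rewrite /xsection/= inE.
Qed.

(** Each late first visit to the interval is followed by an occupation of the
    doubled interval; disjointness of the first visits lets the occupation
    integral bound the probability that there is one. *)
Lemma Pud_return_le z0 r tau x s d : 0 < tau -> 2 * r <= `|z0| -> 0 < r ->
  (forall z, itv z0 r z -> 0 < h z /\ forall t, 0 < t -> t < tau ->
     ((6^-1)%:E <= Pud z [set w | itv z0 (2 * r) (state w t)])%E) ->
  0 < h x -> 0 < s -> 0 < d ->
  (Pud x (\bigcup_j visit (itv z0 r) s d j) * (tau / 6)%:E <=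
   \int[leb]_(t in `[s, +oo[) Pud x [set w | itv z0 (2 * r) (state w t)])%E.
Proof.
move=> tau0 rz0 r0 stay hx s0 d0.
set O := (`]z0 - r, z0 + r[%classic : set R) in stay *.
set B := (`]z0 - 2 * r, z0 + 2 * r[%classic : set R) in stay *.
have mO : measurable O by exact: measurable_itv.
have mB : measurable B by exact: measurable_itv.
pose F := first_visit O s d.
have mF j : measurable (F j) := measurable_first_visit j (ltW s0) (ltW d0) mO.
have tF : trivIset setT F by exact: trivIset_seqDU.
have mUF : measurable (\bigcup_j F j) by exact: bigcupT_measurable.
have mBt t : measurable [set w : D | B (state w t)] by exact: measurable_state_event.
have g0 j : 0 < grid s d j by rewrite ltr_wpDr// mulr_ge0// ltW.
have key j t : grid s d j < t -> t < grid s d j + tau ->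
    ((6^-1)%:E * Pud x (F j) <= Pud x (F j `&` [set w | B (state w t)]))%E.
  move=> jt tj; set T := grid s d j in jt tj.
  pose G := [set w : D | B (state w (t - T))].
  have -> : F j `&` [set w | B (state w t)] = F j `&` path_shift T @^-1` G.
    have T0 : 0 <= T by exact/ltW/g0.
    have tT : 0 <= t - T by rewrite subr_ge0 ltW.
    congr (_ `&` _); apply/seteqP; split=> w; rewrite /G /= /state /=;
    by rewrite (max_r T0) (max_r tT) subrKC.
  rewrite (Pud_markov _ (g0 j)) //; last 3 first.
  - by left.
  - apply: natural_filtration_right.
    exact: natural_filtration_first_visit (ltW s0) (ltW d0) mO.
  - exact: measurable_state_event.
  rewrite -(integral_cst (Pud x) (mF j) (6^-1)%:E).
  apply: ge0_le_integral_subset => [w _|w _|w Fw]; [by rewrite lee_fin|by []|].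
  have Ow : O (state w T) := first_visit_visit Fw.
  have [hw stayw] := stay _ Ow.
  split; last by apply: stayw; lra.
  split => //; exists (state w T); last by left.
  by move: hw; rewrite /state; case: (w T) => //=; rewrite h0 ltxx.
pose c j := ((6^-1)%:E * Pud x (F j))%E.
have c0 j : (0 <= c j)%E by rewrite mule_ge0// lee_fin.
pose I j := `]grid s d j, grid s d j + tau[%classic : set Rm.
have sum_le (t : Rm) : (\sum_(j <oo) c j * (\1_(I j) t)%:E <=
    Pud x [set w | B (state w t)])%E.
  have mFB j : measurable (F j `&` [set w | B (state w t)]) by exact: measurableI.
  have tFB : trivIset setT (fun j => F j `&` [set w | B (state w t)]) 
    by move=> i j _ _ [w [[Fi _] [Fj _]]]; apply: tF => //; exists w.
  have mUFB : measurable (\bigcup_j (F j `&` [set w | B (state w t)])) by exact: bigcupT_measurable.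
  apply: (@le_trans _ _ (Pud x (\bigcup_j (F j `&` [set w | B (state w t)])))); last first.
    by apply: le_measure; rewrite ?inE// => w [j _ []].
  rewrite (measure_semi_bigcup (Pud x) mFB tFB mUFB).
  apply: lee_nneseries => [j _ _|j _]; first by rewrite mule_ge0.
  rewrite indicE; have [|_] := boolP (t \in I j); last by rewrite mule0 measure_ge0.
  by rewrite inE /I /= in_itv/= => /andP[jt tj]; rewrite mule1; exact: key.
have mI j : measurable (I j) by exact: measurable_itv.
have mcI j : measurable_fun setT (fun t : Rm => c j * (\1_(I j) t)%:E)%E.
  by apply: measurable_funeM; apply/measurable_EFinP; exact: measurable_indic.
have mS : measurable (`[s, +oo[%classic : set Rm) by exact: measurable_itv.
apply: (@le_trans _ _ (\int[leb]_(t in `[s, +oo[) \sum_(j <oo) c j * (\1_(I j) t)%:E)%E); last first.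
  apply: ge0_le_integral_subset => // t _.
  by apply: nneseries_ge0 => j _ _; rewrite mule_ge0.
rewrite integral_nneseries//; last 2 first.
- by move=> j; exact: measurable_funTS.
- by move=> j t _; rewrite mule_ge0.
rewrite (seqDU_bigcup_eq (visit O s d)) (measure_semi_bigcup (Pud x) mF tF mUF).
rewrite muleC -nneseriesZl//.
apply: lee_nneseries => [j _ _|j _].
  by rewrite mule_ge0// lee_fin divr_ge0// ltW.
rewrite ge0_integralZl//; last by apply: measurable_funTS; apply/measurable_EFinP; exact: measurable_indic.
rewrite integral_indic// (_ : _ `&` _ = I j); last first.
  apply/setIidPl => t; rewrite /I /= !in_itv/= andbT => /andP[jt _].
  by rewrite ltW// (le_lt_trans _ jt)// lerDl mulr_ge0// ltW.
rewrite [X in (_ <= _ * X)%E]lebesgue_measure_itv/= lte_fin ltrDl tau0 -EFinB addrAC subrr add0r.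
by rewrite /c muleAC -EFinM mulrC.
Qed.

(** By [Pud_return_le], the probability of a visit after time m + 1 is at most a
    constant times a tail of the convergent integral of [potential_bounded]. *)
Lemma recur_null z0 : 0 < h z0 -> exists2 r, 0 < r &
  forall x, 0 < h x -> Pud x (recur (itv z0 r)) = 0%E.
Proof.
move=> hz0; have [r1 r10 HC] := potential_bounded z0.
have [r [tau [r0 rr1 tau0 rz0 stay]]] := Pud_stays hz0 r10.
exists r => // x hx.
have r20 : 0 < 2 * r by rewrite mulr_gt0.
have [C xC] := HC (2 * r) x r20 rr1 hx.
set O := (`]z0 - r, z0 + r[%classic : set R) in stay *.
have mO : measurable O by exact: measurable_itv.
have mB : measurable (itv z0 (2 * r)) by exact: measurable_itv.
have tail := ge0_integral_tail_cvg0 (measurable_occupation x mB) _ _ xC.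
have {}tail := tail (fun t => measure_ge0 _ _) (fun t => fin_num_measure _ _ (measurable_state_event t mB)).
have le m : (Pud x (recur O) * (tau / 6)%:E <=
    \int[leb]_(t in `[m.+1%:R, +oo[) Pud x [set w | itv z0 (2 * r) (state w t)])%E.
  have c0 : 0 < tau / 6 by rewrite divr_gt0.
  rewrite -lee_pdivlMr//.
  apply: (@le_trans _ _ (Pud x (reach O m.+1%:R))).
    apply: le_measure; rewrite ?inE; [exact: measurable_recur|exact: measurable_reach|].
    by move=> w; exact.
  apply: reach_le => // k; rewrite lee_pdivlMr//.
  by apply: Pud_return_le; rewrite ?invr_gt0.
have X0 : (Pud x (recur O) * (tau / 6)%:E <= 0)%E.
  rewrite -(cvg_lim _ tail)//; apply: lime_ge; first by apply/cvg_ex; exists 0%E.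
  exact: nearW.
apply/eqP; rewrite eq_le measure_ge0 andbT.
by move: X0; rewrite -lee_pdivlMr ?mul0e// divr_gt0.
Qed.

Lemma recur_near0 x O M : 0 < h x -> measurable O -> 0 <= M ->
  (forall y, O y -> h y <= M) -> (Pud x (recur O) <= (M / h x)%:E)%E.
Proof.
move=> hx mO M0 OM.
apply: (@le_trans _ _ (Pud x (reach O 1))).
  apply: le_measure; rewrite ?inE; [exact: measurable_recur|exact: measurable_reach|].
  by move=> w /(_ 0%N); exact.
by apply: reach_le => // k; apply: Pud_visit_le; rewrite ?invr_gt0//; left.
Qed.

(** Late visits to a compact set K are late visits to an interval on which the
    potential argument applies, or to a small interval around 0, where the
    conditioned process rarely goes. *)
Lemma late_visits_null (K : set R) : compact K -> K `<=` posset0 h ->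
  exists G : set D, [/\ measurable G, (forall w, late_visits K w -> G w) &
    forall x, 0 < h x -> Pud x G = 0%E].
Proof.
move=> cK KH.
have /choice[rad radP] : forall z, exists r, 0 < h z -> 0 < r /\
    forall x, 0 < h x -> Pud x (recur (itv z r)) = 0%E.
  move=> z.
  have [hz|hz] := ltP 0 (h z); last by exists 0.
  by have [r r0 H] := recur_null hz; exists r.
have /choice[G GP] : forall k : nat, exists Gk : set D, [/\ measurable Gk,
    (forall w, late_visits K w -> Gk w) &
    forall x M, 0 < h x -> 0 <= M -> (forall y, itv 0 k.+1%:R^-1 y -> h y <= M) ->
      (Pud x Gk <= (M / h x)%:E)%E].
  move=> k.
  pose V z := itv z (if z == 0 then k.+1%:R^-1 else rad z).
  have oV z : open (V z) by exact: interval_open.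
  have mV z : measurable (V z) by exact: measurable_itv.
  have : cover_compact K by rewrite -compact_cover.
  move=> /(_ R K V (fun z _ => oV z)) [|fs fsK Kfs].
    move=> z Kz; exists z => //; rewrite /V /= in_itv/= ltrBlDr ltrDl.
    case: eqP => [_|z0]; first by rewrite invr_gt0 ltr0n.
    by have [/radP[->]|/z0] := KH z Kz.
  have [s sK Ks] : exists2 s : seq R, (forall z, z \in s -> K z) &
      forall y, K y -> exists2 z, z \in s & V z y.
    exists (finmap.enum_fset fs) => [z zs|y Ky].
      by have := fsK z zs; rewrite inE.
    by have [z zs Vy] := Kfs y Ky; exists z.
  pose N := \big[setU/set0]_(z <- s | z != 0) recur (V z).
  have [mN N0] : measurable N /\ forall x, 0 < h x -> Pud x N = 0%E.
    pose null (A : set D) := measurable A /\ forall x, 0 < h x -> Pud x A = 0%E.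
    suff : null N by [].
    rewrite /N big_seq_cond; apply: (big_ind null) => [|A B [mA A0] [mB B0]|z /andP[zs z0]].
    - by split => // x _; exact: measure0.
    - split=> [|x hx]; first exact: measurableU.
      by apply: etrans (measureU0 mA mB (B0 x hx)) (A0 x hx).
    - split=> [|x hx]; first exact: measurable_recur.
      rewrite /V (negbTE z0).
      have /KH[/radP[_ H]|/= z00] := sK z zs; first exact: H.
      by rewrite z00 eqxx in z0.
  exists (recur (itv 0 k.+1%:R^-1) `|` N).
  have mI : measurable (itv 0 k.+1%:R^-1) by exact: measurable_itv.
  split.
  - by apply: measurableU => //; exact: measurable_recur.
  - move=> w lw.
    have [|z zs lz] := @late_visits_cover R R s V w.
      move=> m; have [t mt [y wt Ky]] := lw m; exists t => //; exists y => //.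
      exact: Ks.
    have [z0|z0] := eqVneq z 0.
      left; apply: late_visits_recur; first exact: interval_open.
      by move: lz; rewrite z0 /V eqxx.
    right; rewrite /N -bigcup_seq_cond; exists z; first by rewrite /= zs.
    exact: late_visits_recur.
  - move=> x M hx M0 HM.
    have mr := measurable_recur mI.
    apply: le_trans (recur_near0 hx mI M0 HM).
    by rewrite le_eqVlt; apply/orP; left; apply/eqP; apply: measureU0 => //; exact: N0.
exists (\bigcap_k G k).
have mG : measurable (\bigcap_k G k) by apply: bigcap_measurable => // k _; have [] := GP k.
split=> // [w lw k _|x hx]; first by have [_ H _] := GP k; exact: H.
apply/eqP; rewrite eq_le measure_ge0 andbT.
apply/lee_addgt0Pr => e e0; rewrite add0e.
have eh : 0 < e * h x by rewrite mulr_gt0.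
have [r r0 hr] := continuous_near 0 h_continuous eh.
have [k _ /(_ k (leqnn k)) kr] := near_infty_natSinv_lt (PosNum r0).
have [mk _ H] := GP k.
apply: (@le_trans _ _ (Pud x (G k))).
  by apply: le_measure; rewrite ?inE// => w; exact.
apply: (le_trans (H x (e * h x) hx (ltW eh) _)); last by rewrite lee_fin mulfK ?gt_eqF.
move=> y; rewrite /= in_itv/= => yk.
have /hr/andP[_ /ltW] : 0 - r < y < 0 + r.
  move: yk (kr : k.+1%:R^-1 < r); move: (k.+1%:R^-1) => i yi ir.
  by apply/andP; split; lra.
by rewrite h0 add0r.
Qed.

(** The density h vanishes at 0, so that the process started at 0 is almost surely
    at a point where h is positive at time 1. *)
Lemma Pud0_shift_null (G : set D) : measurable G ->
  (forall x, 0 < h x -> Pud x G = 0%E) -> Pud 0 (path_shift 1 @^-1` G) = 0%E.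
Proof.
move=> mG G0.
have m0 : measurable ([set 0] : set R) by exact: measurable_set1.
have nE : natural_filtration 1 (coord_event 1 [set 0] : set D).
  by apply: natural_filtration_coord => //; rewrite ler01 lexx.
have mE := natural_filtration_measurable nE.
have E0 : Pud 0 (coord_event 1 [set 0]) = 0%E.
  have [_ H] := Pud_laws.
  apply: etrans (H 1 _ ltr01 (natural_filtration_right nE)) _.
  by apply: integral0_eq => w [[y w1 /= y0] _]; rewrite /state w1 /= y0 h0.
rewrite -[X in Pud 0 X]setTI.
rewrite (Pud_markov _ ltr01) //; last 2 first.
- by right.
- by apply: natural_filtration_right; exact: natural_filtration_setT.
apply/eqP; rewrite eq_le integral_ge0// andbT -E0.
rewrite -[X in (_ <= Pud 0 X)%E]setIT -integral_indic//.
apply: ge0_le_integral_subset => [w _|w _|w [_ [y w1 Hy]]]; [exact: measure_ge0|by rewrite lee_fin|split => //].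
have -> : state w 1 = y by rewrite /state w1.
rewrite indicE; have [/G0 ->|/= y0] := Hy; first by rewrite lee_fin.
rewrite mem_set; last by exists y => //=; rewrite y0.
exact: probability_le1.
Qed.

Lemma transient_conditioned : transient (posset0 h) Pud.
Proof.
move=> K x cK KH Hx; have [G [mG KG G0]] := late_visits_null cK KH.
have [hx|/= ->] := Hx.
  by exists G; split => // [|w /last_exit_time_late_visits/KG//]; exact: G0.
exists (path_shift 1 @^-1` G); split.
- rewrite -[X in measurable X]setTI; exact: measurable_path_shift.
- exact: Pud0_shift_null.
- by move=> w /last_exit_time_late_visits/late_visits_shift/KG.
Qed.

End conditioned.

Unset Implicit Arguments.

Theorem proposition9 (R : realType)
    (P : probability (cadlag_path R) R) (psi : R -> R[i])
    (u : R -> R -> R) (L : cadlag_path R -> cumulative R R)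
    (n : {sigma_finite_measure set (cadlag_path R) -> \bar R})
    (h : R -> R) (Pud : R -> probability (cadlag_path R) R)
    (P_levy : levy_process P)
    (psiP : char_exponent P psi)
    (P_regular : regular_for_itself P)
    (P_not_cp : ~ compound_poisson psi)
    (psi_int : forall q : R, 0 < q ->
      (\int[@lebesgue_measure R]_lambda ((q + complex.Re (psi lambda))^-1)%:E < +oo)%E)
    (psi_int1 :
      (\int[@lebesgue_measure R]_lambda
         (`|complex.Re ((1 - expi lambda) / psi lambda)|)%:E < +oo)%E)
    (uP : forall q : R, 0 < q -> resolvent_density P q (u q))
    (L_local_time : local_time0 P L)
    (L_normalized : local_time0_normalized P L u)
    (nP : ito_excursion_measure P L n)
    (h_lim : forall x, u q 0 - u q (- x) @[q --> 0^'+] --> h x)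
    (h_ge0 : forall x, 0 <= h x)
    (h_continuous : continuous h)
    (h_invariant : forall x t : R, 0 < t ->
      (\int[law_from P x]_(w in [set w | t%:E < hitting_time0 w])
         (h (state w t))%:E = (h x)%:E)%E)
    (h_n : forall t : R, 0 < t ->
      (\int[n]_(w in [set w | t%:E < lifetime w]) (h (state w t))%:E = 1)%E)
    (Pud_laws : avoiding_zero_laws P n h Pud)
    (Pud_markov : markov_family (posset0 h) Pud) :
  transient (posset0 h) Pud.
Proof.
have h0 : h 0 = 0.
  have := h_lim 0; rewrite oppr0; under eq_fun do rewrite subrr.
  by move=> /(cvg_unique _ (cvg_cst 0))/esym; exact.
exact: (transient_conditioned P_levy h_ge0 h_continuous h0 Pud_laws uP h_lim Pud_markov).
Qed.
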